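(* Consider the AdaSketch-Newton algorithm (defined in the context) applied to $\min_{x\in\mathbb{R}^n} f(x)$ subject to $c(x)=0$. Assume: (i) the iterates $\{(x_k,\lambda_k)\}_{k\ge 0}$ are contained in a convex compact set $\mathcal{X}\times\Lambda$ such that over $\mathcal{X}$ the objective $f$ and the constraint $c$ are twice continuously differentiable with Lipschitz continuous Hessians; (ii) there exist absolute constants $\xi_G,\xi_B,\Upsilon_B>0$ such that for all $k$: $G_k$ has full row rank with $G_kG_k^T\succeq \xi_G I$, $u^TB_ku\ge \xi_B\|u\|^2$ for every $u$ with $G_ku=0$, and $\|B_k\|\le\Upsilon_B$; (iii) there exists a constant $\pi\in(0,1]$ such that the sketching matrices $S_{k,j}\sim S$ are iid and satisfy $P(S^Tu\ne 0)\ge\pi$ for every $u\in\mathbb{R}^{n+m}\setminus\{0\}$. Then, with probability one, $\|\nabla\mathcal{L}_k\|\to 0$ as $k\to\infty$.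
   Context: Problem and notation. $f:\mathbb{R}^n\to\mathbb{R}$ and $c:\mathbb{R}^n\to\mathbb{R}^m$ are twice continuously differentiable. $\|\cdot\|$ is the $\ell_2$ norm for vectors and the operator norm for matrices; $a\vee b=\max\{a,b\}$, $a\wedge b=\min\{a,b\}$; $(\cdot)^\dagger$ is the Moore–Penrose pseudoinverse. $\mathcal{L}(x,\lambda)=f(x)+\lambda^Tc(x)$ is the Lagrangian, $H(x,\lambda)=\nabla_x^2\mathcal{L}(x,\lambda)\in\mathbb{R}^{n\times n}$, and $G(x)=\nabla^Tc(x)\in\mathbb{R}^{m\times n}$ is the Jacobian of $c$. Write $z=(x,\lambda)$; a subscript $k$ denotes evaluation at $z_k=(x_k,\lambda_k)$, so $\nabla\mathcal{L}_k=(\nabla_x\mathcal{L}_k,\,c_k)$ (the KKT residual vector). For $\eta=(\eta_1,\eta_2)$ the exact augmented Lagrangian is $$\mathcal{L}_\eta(x,\lambda)=\mathcal{L}(x,\lambda)+\tfrac{\eta_1}{2}\|c(x)\|^2+\tfrac{\eta_2}{2}\|\nabla_x\mathcal{L}(x,\lambda)\|^2,$$ and $\nabla\mathcal{L}^k_{\eta_k}$ is its gradient in $(x,\lambda)$ at $z_k$ with $\eta=\eta_k=(\eta_{1,k},\eta_{2,k})$. Newton system. $B_k\in\mathbb{R}^{n\times n}$ is a symmetric modification of $H_k$, $\Gamma_k=\begin{pmatrix} B_k & G_k^T \\ G_k & 0 \end{pmatrix}$, and the exact direction $\Delta z_k$ solves $\Gamma_k\Delta z_k=-\nabla\mathcal{L}_k$.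 Sketching solver. $S\in\mathbb{R}^{(n+m)\times d}$ is a random matrix with distribution $\mathcal{P}$ ($d$ may be random). At outer iteration $k$, start from $\tilde\Delta z_{k,0}=0$; at inner iteration $j$ draw a fresh independent copy $S_{k,j}$ of $S$ and set $$\tilde\Delta z_{k,j+1}=\tilde\Delta z_{k,j}-\Gamma_kS_{k,j}(S_{k,j}^T\Gamma_k^2S_{k,j})^\dagger S_{k,j}^Tr_{k,j},\qquad r_{k,j}=\Gamma_k\tilde\Delta z_{k,j}+\nabla\mathcal{L}_k.$$ Auxiliary quantities. With $\sigma_{1,k}$ the least singular value of $G_k$, $$\Psi_k=\frac{20(\|B_k\|^2\vee1)}{(\xi_B\wedge1)(\sigma_{1,k}^2\wedge1)},\quad \Upsilon_k=\|G_k\|\vee\|H_k\|\vee1,\quad \delta_k^{\mathrm{trial}}=\frac{(0.5-\beta)\eta_{2,k}}{(1+\eta_{1,k}+\eta_{2,k})\Upsilon_k^2\Psi_k^2}.$$ Accuracy condition: $\|r_{k,j}\|\le\theta_k\delta_k\|\nabla\mathcal{L}_k\|/(\|\Gamma_k\|\Psi_k)$. Descent direction condition: $(\nabla\mathcal{L}^k_{\eta_k})^T\tilde\Delta z_{k,j}\le-\eta_{2,k}\|\nabla\mathcal{L}_k\|^2/2$. AdaSketch-Newton algorithm. Inputs: initial $z_0$; a sequence $\{\theta_k\}\subseteq(0,1]$; scalars $\eta_{1,0},\eta_{2,0},\xi_B>0$, $\delta_0\in(0,1)$, $\beta\in(0,0.5)$, $\nu>1$. For $k=0,1,2,\dots$: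 (1) compute $f_k,\nabla f_k,c_k,G_k,H_k$, generate $B_k$, compute $\Psi_k,\Upsilon_k,\delta_k^{\mathrm{trial}}$, and set $\delta_k\leftarrow\delta_k\wedge\delta_k^{\mathrm{trial}}$; set the inexact direction to $0$. (2) Until both the accuracy condition and the descent direction condition hold: run the sketching update (continuing from the latest inexact direction) until the accuracy condition holds; then, if the descent direction condition fails, update $\eta_{1,k}\leftarrow\eta_{1,k}\nu^2$, $\eta_{2,k}\leftarrow\eta_{2,k}/\nu$, recompute $\delta_k^{\mathrm{trial}}$, and set $\delta_k\leftarrow(\delta_k/\nu^4)\wedge\delta_k^{\mathrm{trial}}$. (3) Let $\tilde\Delta z_k$ be the resulting direction. Select the stepsize $\alpha_k$ by line search so that it satisfies the Armijo condition $\mathcal{L}_{\eta_k}(z_k+\alpha_k\tilde\Delta z_k)\le\mathcal{L}_{\eta_k}(z_k)+\alpha_k\beta(\nabla\mathcal{L}^k_{\eta_k})^T\tilde\Delta z_k$. Set $z_{k+1}=z_k+\alpha_k\tilde\Delta z_k$. (4) Set $\eta_{1,k+1}\leftarrow\eta_{1,k}$, $\eta_{2,k+1}\leftarrow\eta_{2,k}$, $\delta_{k+1}\leftarrow\delta_k$. The constant $\xi_B$ in the assumption on $B_k$ is the input parameter $\xi_B$. *)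

(* Defs.v *)
From HB Require Import structures.
From mathcomp Require Import all_boot all_order all_algebra.
From mathcomp Require Import all_classical all_reals all_analysis.
Set Implicit Arguments.
Unset Strict Implicit.
Unset Printing Implicit Defensive.
Import Order.TTheory GRing.Theory Num.Theory.
Import numFieldNormedType.Exports.
Local Open Scope classical_set_scope.
Local Open Scope ring_scope.

Section LinearAlgebra.
Context {R : realType}.

Definition dotv p (u v : 'cV[R]_p) : R := (u^T *m v) 0 0.

(* The library norm on matrices is the entrywise maximum, hence l2 here. *)
Definition norm2 p (v : 'cV[R]_p) : R := Num.sqrt (dotv v v).

Definition opnorm p q (A : 'M[R]_(p, q)) : R :=
  sup [set norm2 (A *m u) | u in [set u : 'cV[R]_q | norm2 u <= 1]].

(* For a matrix of full row rank the p singular values are the square roots of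
   the eigenvalues of A A^T. *)
Definition singular_values p q (A : 'M[R]_(p, q)) : set R :=
  [set s | 0 <= s /\ eigenvalue (A *m A^T) (s ^+ 2)].

Definition least_singular_value p q (A : 'M[R]_(p, q)) : R :=
  inf (singular_values A).

Definition penrose p q (A : 'M[R]_(p, q)) (X : 'M[R]_(q, p)) : Prop :=
  [/\ A *m X *m A = A, X *m A *m X = X,
      (A *m X)^T = A *m X & (X *m A)^T = X *m A].

(* The Moore-Penrose pseudoinverse; the library's pinvmx satisfies only some of
   the four equations. *)
Definition mp_pinv p q (A : 'M[R]_(p, q)) : 'M[R]_(q, p) :=
  xget 0 [set X | penrose A X].

End LinearAlgebra.

Section Calculus.
Context {R : realType} {n : nat}.

Definition gradient (g : 'cV[R]_n -> R) (x : 'cV[R]_n) : 'cV[R]_n :=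
  \col_(i < n) 'D_(delta_mx i 0) g x.

(* Row i is the transposed gradient of the i-th component; the library's
   jacobian is for row vectors and has the transposed layout. *)
Definition jac m (c : 'cV[R]_n -> 'cV[R]_m) (x : 'cV[R]_n) : 'M[R]_(m, n) :=
  \matrix_(i < m, j < n) 'D_(delta_mx j 0) (fun y => c y i 0) x.

Definition hessian (g : 'cV[R]_n -> R) : 'cV[R]_n -> 'M[R]_n :=
  jac (gradient g).

Definition twice_continuously_differentiable (g : 'cV[R]_n -> R) : Prop :=
  [/\ forall x, differentiable g x,
      forall x, differentiable (gradient g) x &
      continuous (hessian g)].

Definition hessian_lipschitz_on (X : set 'cV[R]_n) (g : 'cV[R]_n -> R) : Prop :=
  exists L : R, forall x y, X x -> X y ->
    opnorm (hessian g x - hessian g y) <= L * norm2 (x - y).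

End Calculus.

(* Sketching matrices have a fixed number of rows and a number of columns that
   may itself be random. A set of sketches is measurable when, for each number
   of columns, its slice is a Borel set of matrices. *)
Section Measurability.
Context (R : realType).

Definition borel_mx p q := g_sigma_algebraType (@open 'M[R]_(p, q)).

Definition sketch (p : nat) : Type := {d : nat & 'M[R]_(p, d)}.

HB.instance Definition _ p := Choice.on (sketch p).
HB.instance Definition _ p :=
  isPointed.Build (sketch p) (existT (fun d => 'M[R]_(p, d)) 0%N 0).

Definition sketch_measurable p : set (set (sketch p)) :=
  [set A | forall d, measurable
     ((fun M : borel_mx p d => existT (fun d => 'M[R]_(p, d)) d M) @^-1` A)].

Lemma sketch_measurable0 p : @sketch_measurable p set0.
Proof. by move=> d; rewrite preimage_set0; exact: measurable0. Qed.

Lemma sketch_measurableC p (A : set (sketch p)) :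
  sketch_measurable A -> sketch_measurable (~` A).
Proof. by move=> mA d; apply: measurableC; exact: mA. Qed.

Lemma sketch_measurable_bigcup p (F : (set (sketch p))^nat) :
  (forall i, sketch_measurable (F i)) -> sketch_measurable (\bigcup_i F i).
Proof.
move=> mF d; rewrite preimage_bigcup.
by apply: bigcupT_measurable => i; exact: mF.
Qed.

HB.instance Definition _ p := @isMeasurable.Build default_measure_display
  (sketch p) (@sketch_measurable p) (@sketch_measurable0 p)
  (@sketch_measurableC p) (@sketch_measurable_bigcup p).

End Measurability.

Section Problem.
Context {R : realType} {n m : nat}.
Variables (f : 'cV[R]_n -> R) (c : 'cV[R]_n -> 'cV[R]_m).

Definition lagrangian (x : 'cV[R]_n) (lambda : 'cV[R]_m) : R :=
  f x + dotv lambda (c x).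

Definition grad_x_lagrangian (x : 'cV[R]_n) (lambda : 'cV[R]_m) : 'cV[R]_n :=
  gradient (lagrangian^~ lambda) x.

Definition hess_x_lagrangian (x : 'cV[R]_n) (lambda : 'cV[R]_m) : 'M[R]_n :=
  hessian (lagrangian^~ lambda) x.

(* A primal-dual point z = (x, lambda) is the stacked vector col_mx x lambda. *)
Implicit Type z : 'cV[R]_(n + m).

Definition kkt_residual z : 'cV[R]_(n + m) :=
  col_mx (grad_x_lagrangian (usubmx z) (dsubmx z)) (c (usubmx z)).

Definition aug_lagrangian (eta1 eta2 : R) z : R :=
  lagrangian (usubmx z) (dsubmx z)
  + eta1 / 2 * norm2 (c (usubmx z)) ^+ 2
  + eta2 / 2 * norm2 (grad_x_lagrangian (usubmx z) (dsubmx z)) ^+ 2.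

Definition newton_mx (B : 'M[R]_n) (G : 'M[R]_(m, n)) : 'M[R]_(n + m) :=
  block_mx B G^T G 0.

End Problem.

Record inputs (R : realType) := Inputs {
  theta : nat -> R;
  xi_B : R;
  beta : R;
  nu : R;
  (* first trial stepsize and reduction factor of the line search *)
  alpha_max : R;
  rho : R }.

(* State of the inner loop: number of sketching updates performed so far and
   current values of eta_1, eta_2 and delta. *)
Record inner_state (R : realType) := InnerState {
  inner_j : nat;
  inner_eta1 : R;
  inner_eta2 : R;
  inner_delta : R }.

Section Sketching.
Context {R : realType} {p : nat}.

Definition sketch_update (Gamma : 'M[R]_p) (g : 'cV[R]_p) (S : sketch R p)
    (dz : 'cV[R]_p) : 'cV[R]_p :=
  let M : 'M[R]_(p, tag S) := tagged S in
  let r := Gamma *m dz + g in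
  dz - Gamma *m M *m mp_pinv (M^T *m (Gamma *m Gamma) *m M) *m M^T *m r.

Fixpoint sketch_iterate (Gamma : 'M[R]_p) (g : 'cV[R]_p)
    (S : nat -> sketch R p) (j : nat) : 'cV[R]_p :=
  if j is j'.+1 then
    sketch_update Gamma g (S j') (sketch_iterate Gamma g S j')
  else 0.

End Sketching.

Section OuterIteration.
Context {R : realType} {n m : nat}.
Variables (f : 'cV[R]_n -> R) (c : 'cV[R]_n -> 'cV[R]_m) (prm : inputs R).
Variables (thetak : R) (z : 'cV[R]_(n + m)) (B : 'M[R]_n).
Variable (S : nat -> sketch R (n + m)).

Let x : 'cV[R]_n := usubmx z.
Let lambda : 'cV[R]_m := dsubmx z.
Let G : 'M[R]_(m, n) := jac c x.
Let Gamma : 'M[R]_(n + m) := newton_mx B G.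
Let gradL : 'cV[R]_(n + m) := kkt_residual f c z.

Definition Psi : R :=
  20 * Num.max (opnorm B ^+ 2) 1
  / (Num.min (xi_B prm) 1 * Num.min (least_singular_value G ^+ 2) 1).

Definition Upsilon : R :=
  Num.max (Num.max (opnorm G) (opnorm (hess_x_lagrangian f c x lambda))) 1.

Definition delta_trial (eta1 eta2 : R) : R :=
  (2^-1 - beta prm) * eta2
  / ((1 + eta1 + eta2) * Upsilon ^+ 2 * Psi ^+ 2).

Definition direction (j : nat) : 'cV[R]_(n + m) :=
  sketch_iterate Gamma gradL S j.

Definition accuracy (s : inner_state R) : Prop :=
  norm2 (Gamma *m direction (inner_j s) + gradL)
  <= thetak * inner_delta s * norm2 gradL / (opnorm Gamma * Psi).

Definition descent_direction (s : inner_state R) : Prop :=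
  dotv (gradient (aug_lagrangian f c (inner_eta1 s) (inner_eta2 s)) z)
       (direction (inner_j s))
  <= - (inner_eta2 s * norm2 gradL ^+ 2 / 2).

Definition sketching_step (s : inner_state R) : inner_state R :=
  InnerState (inner_j s).+1 (inner_eta1 s) (inner_eta2 s) (inner_delta s).

Definition penalty_step (s : inner_state R) : inner_state R :=
  let eta1 := inner_eta1 s * nu prm ^+ 2 in
  let eta2 := inner_eta2 s / nu prm in
  InnerState (inner_j s) eta1 eta2
    (Num.min (inner_delta s / nu prm ^+ 4) (delta_trial eta1 eta2)).

(* inner_loop s s' : started in state s, the loop terminates, in state s'. *)
Inductive inner_loop : inner_state R -> inner_state R -> Prop :=
| inner_stop s :
    accuracy s -> descent_direction s -> inner_loop s s
| inner_sketch s s' :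
    ~ accuracy s -> inner_loop (sketching_step s) s' -> inner_loop s s'
| inner_penalty s s' :
    accuracy s -> ~ descent_direction s ->
    inner_loop (penalty_step s) s' -> inner_loop s s'.

Definition inner_start (eta1 eta2 delta : R) : inner_state R :=
  InnerState 0 eta1 eta2 (Num.min delta (delta_trial eta1 eta2)).

Definition armijo (s : inner_state R) (alpha : R) : Prop :=
  let Leta := aug_lagrangian f c (inner_eta1 s) (inner_eta2 s) in
  let dz := direction (inner_j s) in
  Leta (z + alpha *: dz) <= Leta z + alpha * beta prm * dotv (gradient Leta z) dz.

(* Backtracking: the first of alpha_max, alpha_max * rho, alpha_max * rho^2, ...
   that satisfies the Armijo condition. *)
Definition line_search (s : inner_state R) (alpha : R) : Prop :=
  exists t : nat,
    [/\ alpha = alpha_max prm * rho prm ^+ t,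
        armijo s alpha &
        forall t' : nat, (t' < t)%N -> ~ armijo s (alpha_max prm * rho prm ^+ t')].

End OuterIteration.

(* One realization of the algorithm. The quantities indexed by k are those at
   the start of outer iteration k, so that the penalty parameters written
   eta_k in the line search are eta1 k.+1 and eta2 k.+1. If the inner loop of
   iteration k does not terminate, nothing is assumed about what follows: its
   termination is not a hypothesis. *)
Record adasketch_newton (R : realType) (n m : nat)
    (f : 'cV[R]_n -> R) (c : 'cV[R]_n -> 'cV[R]_m) (prm : inputs R)
    (z0 : 'cV[R]_(n + m)) (eta10 eta20 delta0 : R)
    (S : nat -> nat -> sketch R (n + m))
    (z : nat -> 'cV[R]_(n + m)) (B : nat -> 'M[R]_n)
    (eta1 eta2 delta : nat -> R) : Prop := AdaSketchNewton {
  adasketch_init :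
    [/\ z 0%N = z0, eta1 0%N = eta10, eta2 0%N = eta20 & delta 0%N = delta0];
  adasketch_sym : forall k, (B k)^T = B k;
  adasketch_step : forall k s,
    inner_loop f c prm (theta prm k) (z k) (B k) (S k)
      (inner_start f c prm (z k) (B k) (eta1 k) (eta2 k) (delta k)) s ->
    [/\ exists2 alpha, line_search f c prm (z k) (B k) (S k) s alpha &
          z k.+1 = z k + alpha *: direction f c (z k) (B k) (S k) (inner_j s),
        eta1 k.+1 = inner_eta1 s,
        eta2 k.+1 = inner_eta2 s &
        delta k.+1 = inner_delta s] }.

Section Randomness.
Context {d : measure_display} {Omega : measurableType d} {R : realType}.
Variable P : probability Omega R.

(* Mutual independence of a family of sigma-algebras. *)
Definition independent_sigma (I : eqType) (F : I -> set (set Omega)) : Prop :=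
  forall (s : seq I) (E : I -> set Omega), uniq s ->
    (forall i, i \in s -> F i (E i)) ->
    P (\bigcap_(i in [set` s]) E i) = (\prod_(i <- s) P (E i))%E.

Context {n m : nat}.
Variables (S : nat -> nat -> {RV P >-> sketch R (n + m)}).
Variables (z : nat -> {RV P >-> borel_mx R (n + m) 1}).
Variables (B : nat -> {RV P >-> borel_mx R n n}).

(* What has been generated when the sketches of iteration k are drawn: the
   iterates and the matrices B up to iteration k and all earlier sketches. *)
Definition history (k : nat) : set (set Omega) :=
  <<s \bigcup_(i in [set i | (i <= k)%N])
        (g_sigma_algebra_preimage (z i) `|` g_sigma_algebra_preimage (B i))
      `|` \bigcup_(i in [set i | (i < k)%N]) \bigcup_j
        g_sigma_algebra_preimage (S i j) >>.

(* Every sketch has law mu, and for every k the sketches S k 0, S k 1, ... are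
   independent of each other and of the history. *)
Definition fresh_iid_sketches (mu : probability (sketch R (n + m)) R) : Prop :=
  (forall k j A, measurable A -> distribution P (S k j) A = mu A) /\
  (forall k, independent_sigma (fun o : option nat =>
     if o is Some j then g_sigma_algebra_preimage (S k j) else history k)).

End Randomness.

(* Main.v *)
Require Import Defs.
From HB Require Import structures.
From mathcomp Require Import all_boot all_order all_algebra.
From mathcomp Require Import ring lra.
From mathcomp Require Import all_classical all_reals all_analysis.
From mathcomp Require Import measurable_realfun.
Set Implicit Arguments.
Unset Strict Implicit.
Unset Printing Implicit Defensive.
Import Order.TTheory GRing.Theory Num.Theory.
Import numFieldNormedType.Exports.
Local Open Scope classical_set_scope.
Local Open Scope ring_scope.

(** The proof separates what one realization of the algorithm does, given that
    its inner solver converges, from the probabilistic fact that the inner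
    solver does converge.

    Sketching. Let [dzs] be the exact direction of an outer iteration. A
    sketching update with sketch [M] removes from the error [dz - dzs] its
    orthogonal projection onto the range of [Gamma *m M]
    ([sketch_update_error]), so that the squared error decreases by the captured
    energy [captured]. By the hypothesis on the sketches and the compactness of
    the unit sphere, the expectation of the captured energy is at least a
    fraction [kappa > 0], which depends on [Gamma], of the squared error
    ([mean_captured_lower]). Each sketch is independent of everything that
    precedes it ([past_indep]), so the expected captured energies may be computed
    with the error frozen ([ge0_integral_freezing]); they telescope and have a
    finite sum, which forces the errors to zero almost surely ([error_to_zero]).
    Measurability of the projections, which involve a pseudoinverse, comes from
    the distance to a column space being a countable infimum.

    Penalty parameters. Along the exact direction the derivative of the augmented
    Lagrangian is at most [- 3/4 * eta2] times the squared KKT residual, provided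
    that [eta2] is small and [eta1 * eta2] is large ([exact_descent]). After [t]
    penalty steps [eta1] is of order [nu ^ 2t], [eta2] of order [nu ^ -t] and
    [delta] at most [nu ^ -4t]; hence for large [t] these conditions hold and the
    inexactness, of order [eta1 * delta], is negligible against [eta2]: the
    accuracy condition implies the descent condition ([descent_threshold]). With
    convergent inner solvers, every inner loop therefore terminates
    ([inner_loop_terminates]), and the total number of penalty steps is bounded
    ([penalty_stabilizes]).

    Descent. Once the parameters are constant, the augmented Lagrangian is a
    fixed continuously differentiable function that decreases along the
    iterates and is bounded below on the compact set that contains them. Its
    gradient is uniformly continuous near that set, so the line search accepts
    all steps below a threshold that depends only on a lower bound for the KKT
    residual ([armijo_short_steps]). A residual that exceeded some [e > 0]
    infinitely often would thus lower the function by a fixed amount infinitely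
    often, which is impossible ([realization_converges]). *)

(** * Euclidean norms and orthogonal projections *)

Section Euclidean.
Context {R : realType}.

Lemma dotvE p (u v : 'cV[R]_p) : dotv u v = \sum_i u i 0 * v i 0.
Proof. by rewrite /dotv mxE; apply: eq_bigr => i _; rewrite mxE. Qed.

Lemma dotvC p (u v : 'cV[R]_p) : dotv u v = dotv v u.
Proof. by rewrite !dotvE; apply: eq_bigr => i _; rewrite mulrC. Qed.

Lemma dotvDr p (u v w : 'cV[R]_p) : dotv u (v + w) = dotv u v + dotv u w.
Proof. by rewrite /dotv mulmxDr mxE. Qed.

Lemma dotvNr p (u v : 'cV[R]_p) : dotv u (- v) = - dotv u v.
Proof. by rewrite /dotv mulmxN mxE. Qed.

Lemma dotvZr p a (u v : 'cV[R]_p) : dotv u (a *: v) = a * dotv u v.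
Proof. by rewrite /dotv -scalemxAr mxE. Qed.

Lemma dotvDl p (u v w : 'cV[R]_p) : dotv (v + w) u = dotv v u + dotv w u.
Proof. by rewrite dotvC dotvDr !(dotvC u). Qed.

Lemma dotvNl p (u v : 'cV[R]_p) : dotv (- v) u = - dotv v u.
Proof. by rewrite dotvC dotvNr dotvC. Qed.

Lemma dotvZl p a (u v : 'cV[R]_p) : dotv (a *: v) u = a * dotv v u.
Proof. by rewrite dotvC dotvZr dotvC. Qed.

Lemma dotv0r p (u : 'cV[R]_p) : dotv u 0 = 0.
Proof. by rewrite /dotv mulmx0 mxE. Qed.

Lemma dotv0l p (u : 'cV[R]_p) : dotv 0 u = 0.
Proof. by rewrite dotvC dotv0r. Qed.

Lemma dotv_mulmx p q (A : 'M[R]_(p, q)) u v :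
  dotv u (A *m v) = dotv (A^T *m u) v.
Proof. by rewrite /dotv trmx_mul trmxK mulmxA. Qed.

Lemma dotv_sumr p (I : Type) (s : seq I) (u : 'cV[R]_p) (F : I -> 'cV[R]_p) :
  dotv u (\sum_(i <- s) F i) = \sum_(i <- s) dotv u (F i).
Proof. by rewrite /dotv mulmx_sumr summxE. Qed.

Lemma dotv_suml p (I : Type) (s : seq I) (u : 'cV[R]_p) (F : I -> 'cV[R]_p) :
  dotv (\sum_(i <- s) F i) u = \sum_(i <- s) dotv (F i) u.
Proof.
by rewrite dotvC dotv_sumr; apply: eq_bigr => i _; rewrite dotvC.
Qed.

Lemma dotv_delta p (u : 'cV[R]_p) i : dotv u (delta_mx i 0) = u i 0.
Proof.
rewrite dotvE (bigD1 i) //= mxE !eqxx mulr1 big1 ?addr0// => j ji.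
by rewrite mxE (negbTE ji) mulr0.
Qed.

Lemma dotv_col_mx p q (a a' : 'cV[R]_p) (b b' : 'cV[R]_q) :
  dotv (col_mx a b) (col_mx a' b') = dotv a a' + dotv b b'.
Proof. by rewrite /dotv tr_col_mx mul_row_col mxE. Qed.

Lemma dotv_ge0 p (u : 'cV[R]_p) : 0 <= dotv u u.
Proof. by rewrite dotvE sumr_ge0// => i _; rewrite -expr2 sqr_ge0. Qed.

Lemma dotv_eq0 p (u : 'cV[R]_p) : (dotv u u == 0) = (u == 0).
Proof.
apply/idP/eqP => [|->]; last by rewrite dotv0r.
rewrite dotvE psumr_eq0; last by move=> i _; rewrite -expr2 sqr_ge0.
move=> /allP u0; apply/colP => i; rewrite mxE; apply/eqP.
by have := u0 i (mem_index_enum _); rewrite /= mulf_eq0 orbb.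
Qed.

Lemma norm2_ge0 p (u : 'cV[R]_p) : 0 <= norm2 u.
Proof. exact: sqrtr_ge0. Qed.

Lemma norm2_sqr p (u : 'cV[R]_p) : norm2 u ^+ 2 = dotv u u.
Proof. by rewrite sqr_sqrtr// dotv_ge0. Qed.

Lemma norm2_eq0 p (u : 'cV[R]_p) : (norm2 u == 0) = (u == 0).
Proof. by rewrite -dotv_eq0 -norm2_sqr sqrf_eq0. Qed.

Lemma norm2_gt0 p (u : 'cV[R]_p) : (0 < norm2 u) = (u != 0).
Proof. by rewrite lt_def norm2_ge0 andbT norm2_eq0. Qed.

Lemma norm20 p : norm2 (0 : 'cV[R]_p) = 0.
Proof. by apply/eqP; rewrite norm2_eq0. Qed.

Lemma ler_norm2 p q (u : 'cV[R]_p) (a : R) (b : 'cV[R]_q) : 0 <= a ->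
  dotv u u <= a ^+ 2 * dotv b b -> norm2 u <= a * norm2 b.
Proof.
move=> a0 h; rewrite -(ler_pXn2r (_ : 0 < 2)%N) ?nnegrE ?mulr_ge0 ?norm2_ge0//.
by rewrite exprMn !norm2_sqr.
Qed.

Lemma norm2Z p a (u : 'cV[R]_p) : norm2 (a *: u) = `|a| * norm2 u.
Proof.
by rewrite /norm2 dotvZl dotvZr mulrA -expr2 sqrtrM ?sqr_ge0// sqrtr_sqr.
Qed.

Lemma norm2N p (u : 'cV[R]_p) : norm2 (- u) = norm2 u.
Proof. by rewrite /norm2 dotvNl dotvNr opprK. Qed.

(** The square of Cauchy-Schwarz is the nonnegativity of the squared norm of
    the component of [u] orthogonal to [v]. *)
Lemma dotv_sqr_le p (u v : 'cV[R]_p) : dotv u v ^+ 2 <= dotv u u * dotv v v.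
Proof.
have [->|v0] := eqVneq v 0; first by rewrite !dotv0r expr0n mulr0.
have vv : 0 < dotv v v by rewrite lt_def dotv_ge0 dotv_eq0 v0.
have := dotv_ge0 (dotv v v *: u - dotv u v *: v).
rewrite !(dotvDl, dotvDr, dotvNl, dotvNr, dotvZl, dotvZr) (dotvC v u) => h.
rewrite -(ler_pM2l vv) -subr_ge0; apply: le_trans h _.
by rewrite le_eqVlt; apply/orP; left; apply/eqP; ring.
Qed.

Lemma dotv_norm2 p (u v : 'cV[R]_p) : `|dotv u v| <= norm2 u * norm2 v.
Proof.
rewrite -(ler_pXn2r (_ : 0 < 2)%N) ?nnegrE ?mulr_ge0 ?norm2_ge0//.
by rewrite real_normK ?num_real// exprMn !norm2_sqr dotv_sqr_le.
Qed.

Lemma dotv_le p (u v : 'cV[R]_p) : dotv u v <= norm2 u * norm2 v.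
Proof. exact: le_trans (ler_norm _) (dotv_norm2 _ _). Qed.

Lemma norm2D p (u v : 'cV[R]_p) : norm2 (u + v) <= norm2 u + norm2 v.
Proof.
rewrite -(ler_pXn2r (_ : 0 < 2)%N) ?nnegrE ?addr_ge0 ?norm2_ge0//.
rewrite sqrrD !norm2_sqr !(dotvDl, dotvDr) (dotvC v u).
have := dotv_le u v; lra.
Qed.

Lemma norm2B p (u v : 'cV[R]_p) : norm2 (u - v) <= norm2 u + norm2 v.
Proof. by rewrite -(norm2N v); exact: norm2D. Qed.

Lemma norm2_coord p (u : 'cV[R]_p) i : `|u i 0| <= norm2 u.
Proof.
rewrite -(ler_pXn2r (_ : 0 < 2)%N) ?nnegrE ?norm2_ge0//.
rewrite real_normK ?num_real// norm2_sqr dotvE (bigD1 i)//= -expr2 lerDl.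
by rewrite sumr_ge0// => j _; rewrite -expr2 sqr_ge0.
Qed.

Lemma norm2_col_mx p q (a : 'cV[R]_p) (b : 'cV[R]_q) :
  norm2 (col_mx a b) ^+ 2 = norm2 a ^+ 2 + norm2 b ^+ 2.
Proof. by rewrite !norm2_sqr dotv_col_mx. Qed.

Lemma norm2_col_mxl p q (a : 'cV[R]_p) (b : 'cV[R]_q) :
  norm2 a <= norm2 (col_mx a b).
Proof.
rewrite -(ler_pXn2r (_ : 0 < 2)%N) ?nnegrE ?norm2_ge0// norm2_col_mx.
by rewrite lerDl sqr_ge0.
Qed.

Lemma norm2_col_mxr p q (a : 'cV[R]_p) (b : 'cV[R]_q) :
  norm2 b <= norm2 (col_mx a b).
Proof.
rewrite -(ler_pXn2r (_ : 0 < 2)%N) ?nnegrE ?norm2_ge0// norm2_col_mx.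
by rewrite lerDr sqr_ge0.
Qed.

Lemma norm2_col_mx_le p q (a : 'cV[R]_p) (b : 'cV[R]_q) :
  norm2 (col_mx a b) <= norm2 a + norm2 b.
Proof.
rewrite -(ler_pXn2r (_ : 0 < 2)%N) ?nnegrE ?addr_ge0 ?norm2_ge0//.
rewrite norm2_col_mx.
have := mulr_ge0 (norm2_ge0 a) (norm2_ge0 b); nra.
Qed.

(** The Frobenius norm is a bound on the operator norm that is an explicit
    function of the entries, hence inherits their bounds. *)
Definition frobenius p q (A : 'M[R]_(p, q)) : R :=
  Num.sqrt (\sum_i \sum_j A i j ^+ 2).

Lemma frobenius_ge0 p q (A : 'M[R]_(p, q)) : 0 <= frobenius A.
Proof. exact: sqrtr_ge0. Qed.

Lemma norm2_mulmx_frobenius p q (A : 'M[R]_(p, q)) u :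
  norm2 (A *m u) <= frobenius A * norm2 u.
Proof.
apply: ler_norm2; first exact: frobenius_ge0.
rewrite sqr_sqrtr; last first.
  by apply: sumr_ge0 => i _; apply: sumr_ge0 => j _; rewrite sqr_ge0.
rewrite dotvE mulr_suml; apply: ler_sum => i _.
have := dotv_sqr_le (row i A)^T u.
have -> : dotv (row i A)^T u = (A *m u) i 0.
  by rewrite /dotv trmxK -row_mul mxE.
rewrite -expr2 dotvE.
by under eq_bigr do rewrite !mxE -expr2.
Qed.

Lemma frobenius_tr p q (A : 'M[R]_(p, q)) : frobenius A^T = frobenius A.
Proof.
rewrite /frobenius exchange_big; congr Num.sqrt.
by apply: eq_bigr => i _; apply: eq_bigr => j _; rewrite mxE.
Qed.

Lemma opnorm_ge p q (A : 'M[R]_(p, q)) u : norm2 u <= 1 ->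
  norm2 (A *m u) <= opnorm A.
Proof.
move=> u1; apply: ub_le_sup; last by exists u.
exists (frobenius A) => _ [v /= v1 <-].
apply: le_trans (norm2_mulmx_frobenius A v) _.
by rewrite ler_piMr// frobenius_ge0.
Qed.

Lemma opnorm_ge0 p q (A : 'M[R]_(p, q)) : 0 <= opnorm A.
Proof.
by apply: le_trans (norm2_ge0 (A *m 0)) (opnorm_ge _ _); rewrite norm20.
Qed.

Lemma norm2_mulmx p q (A : 'M[R]_(p, q)) u :
  norm2 (A *m u) <= opnorm A * norm2 u.
Proof.
have [->|u0] := eqVneq u 0; first by rewrite mulmx0 !norm20 mulr0.
have nu : 0 < norm2 u by rewrite norm2_gt0.
rewrite -ler_pdivrMr// mulrC -[(norm2 u)^-1]gtr0_norm ?invr_gt0//.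
rewrite -norm2Z scalemxAr; apply: opnorm_ge.
by rewrite norm2Z gtr0_norm ?invr_gt0// mulVf// gt_eqF.
Qed.

End Euclidean.

Section MoorePenrose.
Context {R : realType}.

Lemma mulmx_tr_mul0 q r (D : 'M[R]_(q, r)) :
  D^T *m D = 0 -> D = 0.
Proof.
move=> DD; apply/matrixP => i j; rewrite mxE; apply/eqP.
have : dotv (col j D) (col j D) = 0.
  transitivity ((D^T *m D) j j); last by rewrite DD mxE.
  by rewrite dotvE mxE; apply: eq_bigr => k _; rewrite !mxE.
move/eqP; rewrite dotv_eq0 => /eqP /colP /(_ i).
by rewrite !mxE => ->.
Qed.

Lemma row_free_mul_tr p q (A : 'M[R]_(p, q)) : row_free A ->
  A *m A^T \in unitmx.
Proof.
move=> Af; rewrite -row_free_unit -kermx_eq0; apply/eqP/row_matrixP => i.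
rewrite row0; set v := row i _.
have vAA : v *m (A *m A^T) = 0 by rewrite -row_mul mulmx_ker row0.
apply: (row_free_inj Af); rewrite mul0mx -[v *m A]trmxK.
rewrite (@mulmx_tr_mul0 _ _ (v *m A)^T) ?trmx0//.
by rewrite trmxK trmx_mul mulmxA -(mulmxA v) vAA mul0mx.
Qed.

(** The classical formula for the pseudoinverse of a full-rank factorization
    [A = C *m F], whose Gram matrices are invertible over the reals. *)
Lemma penrose_exists p q (A : 'M[R]_(p, q)) : exists X, penrose A X.
Proof.
have [r [C [F [CF Ff Cf]]]] : exists r (C : 'M[R]_(p, r)) (F : 'M[R]_(r, q)),
    [/\ A = C *m F, row_free F & row_free C^T].
  exists (\rank A), (col_base A), (row_base A).
  split; [by rewrite mulmx_base|exact: row_base_free|].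
  by rewrite /row_free mxrank_tr; exact: col_base_full.
have Fu : F *m F^T \in unitmx by exact: row_free_mul_tr.
have Cu : C^T *m C \in unitmx.
  by rewrite -{2}[C]trmxK; exact: row_free_mul_tr.
exists (F^T *m invmx (F *m F^T) *m invmx (C^T *m C) *m C^T).
have CC : A *m (F^T *m invmx (F *m F^T) *m invmx (C^T *m C) *m C^T)
    = C *m invmx (C^T *m C) *m C^T.
  by rewrite CF !mulmxA -(mulmxA C F) -(mulmxA C (F *m _)) mulmxV// mulmx1.
have FF : (F^T *m invmx (F *m F^T) *m invmx (C^T *m C) *m C^T) *m A
    = F^T *m invmx (F *m F^T) *m F.
  rewrite CF !mulmxA -(mulmxA _ C^T C) -(mulmxA _ (invmx (C^T *m C)) (C^T *m C)).
  by rewrite mulVmx// mulmx1.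
split.
- by rewrite CC CF -!mulmxA (mulmxA C^T) (mulmxA (invmx _)) mulVmx// mul1mx.
- rewrite FF -!mulmxA (mulmxA F F^T) (mulmxA (invmx (F *m F^T)) (F *m F^T)).
  by rewrite mulVmx// mul1mx.
- by rewrite CC !trmx_mul trmxK trmx_inv trmx_mul trmxK mulmxA.
- by rewrite FF !trmx_mul trmxK trmx_inv trmx_mul trmxK mulmxA.
Qed.

Lemma mp_pinvP p q (A : 'M[R]_(p, q)) : penrose A (mp_pinv A).
Proof. by rewrite /mp_pinv; case: xgetP => [X -> //|no]; have [X /no] := penrose_exists A. Qed.

(** [mp_pinv (A^T *m A) *m A^T] solves the least squares problem for the columns
    of [A]; hence this is the orthogonal projector onto the column space,
    whatever the rank of [A]. *)
Definition range_proj p q (A : 'M[R]_(p, q)) : 'M[R]_p :=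
  A *m mp_pinv (A^T *m A) *m A^T.

(** The defect [D] of this identity is killed by [A^T], and [D^T] has the form
    [Z *m A^T]; so [D^T *m D = 0]. *)
Lemma range_proj_mul p q (A : 'M[R]_(p, q)) : range_proj A *m A = A.
Proof.
have [N1 _ _ _] := mp_pinvP (A^T *m A).
apply/eqP; rewrite -subr_eq0; apply/eqP; set D := _ - _.
have AD : A^T *m D = 0.
  by rewrite /D mulmxBr /range_proj !mulmxA; move: N1; rewrite !mulmxA => ->; rewrite subrr.
apply: mulmx_tr_mul0.
have -> : D^T = A^T *m (A *m (mp_pinv (A^T *m A))^T *m A^T) - A^T.
  by rewrite /D raddfB /= /range_proj !trmx_mul trmxK !mulmxA.
by rewrite mulmxBl -!mulmxA AD !mulmx0 subr0.
Qed.

Lemma range_proj_tr p q (A : 'M[R]_(p, q)) : (range_proj A)^T = range_proj A.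
Proof.
have h : range_proj A *m (range_proj A)^T = (range_proj A)^T.
  by rewrite {2 3}/range_proj !trmx_mul trmxK !mulmxA range_proj_mul.
have h' : (range_proj A *m (range_proj A)^T)^T = range_proj A *m (range_proj A)^T.
  by rewrite trmx_mul trmxK.
by rewrite -{1}h -h' h trmxK.
Qed.

Lemma range_proj_idem p q (A : 'M[R]_(p, q)) :
  range_proj A *m range_proj A = range_proj A.
Proof. by rewrite {2 3}/range_proj !mulmxA range_proj_mul. Qed.

Lemma tr_mul_range_proj p q (A : 'M[R]_(p, q)) : A^T *m range_proj A = A^T.
Proof. by rewrite -{1}range_proj_tr -trmx_mul range_proj_mul. Qed.

End MoorePenrose.

(** * The least singular value of a matrix of full row rank *)

Section LeastSingularValue.
Context {R : realType}.

Lemma continuous_sum (T : topologicalType) (I : Type) (s : seq I) (P : pred I)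
  (F : I -> T -> R) : (forall i, continuous (F i)) ->
  continuous (fun x => \sum_(i <- s | P i) F i x).
Proof.
move=> Fc; apply: continuous_big => [|i _ //].
by move=> x; apply: (@continuousD _ _ _ fst snd x); [exact: cvg_fst|exact: cvg_snd].
Qed.

Lemma continuous_mul (T : topologicalType) (F G : T -> R) : continuous F ->
  continuous G -> continuous (fun x => F x * G x).
Proof. by move=> Fc Gc x; apply: (@continuousM _ _ F G); [exact: Fc|exact: Gc]. Qed.

Lemma bounded_unit_rV p (A : set 'rV[R]_p) :
  (forall v i, A v -> `|v 0 i| <= 1) -> bounded_set A.
Proof.
move=> A1; exists 1; split; first exact: num_real.
move=> x x1 v Av; rewrite /Num.norm/= mx_normrE; apply: bigmax_le => [|[i j] _ /=].
  exact: le_trans ler01 (ltW x1).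
by rewrite (ord1 i); exact: le_trans (A1 _ _ Av) (ltW x1).
Qed.

(** If [N *m c] were nonzero, a short step from [c] against it would make the
    quadratic form negative. *)
Lemma psd_ker p (N : 'M[R]_p) c : N^T = N -> (forall v, 0 <= dotv v (N *m v)) ->
  dotv c (N *m c) = 0 -> N *m c = 0.
Proof.
move=> Ns Npsd c0; set w := N *m c.
have q0 := Npsd w; set q := dotv w (N *m w) in q0.
pose t := - (dotv w w / (1 + q)).
have q1 : 0 < 1 + q by rewrite ltr_wpDr.
have := Npsd (c + t *: w).
rewrite mulmxDr -scalemxAr !(dotvDl, dotvDr, dotvZl, dotvZr) c0 -/w -/q.
have -> : dotv c (N *m w) = dotv w w by rewrite dotv_mulmx Ns.
move=> h; apply/eqP; rewrite -dotv_eq0 eq_le dotv_ge0 andbT.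
have tE : t * (1 + q) = - dotv w w by rewrite /t mulNr divfK// gt_eqF.
have wE : dotv w w = - (t * (1 + q)) by rewrite tE opprK.
move: h; rewrite wE => h.
have : 0 <= - (t ^+ 2 * (2 + q)) by apply: le_trans h _; rewrite le_eqVlt; apply/orP; left; apply/eqP; ring.
rewrite oppr_ge0 => t2.
have : t = 0.
  apply/eqP; rewrite -sqrf_eq0 eq_le sqr_ge0 andbT.
  by rewrite -(pmulr_lle0 _ (_ : 0 < 2 + q)) ?ltr_wpDr// mulrC.
by move=> ->; rewrite mul0r oppr0.
Qed.

Lemma continuous_to_mx (T : topologicalType) p q (F : T -> 'M[R]_(p, q)) :
  (forall i j, continuous (fun x => F x i j)) -> continuous F.
Proof.
move=> Fc x A [P xP sPA].
apply: filterS (_ : \forall y \near x, forall i j, P i j (F y i j)).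
  by move=> y; exact: sPA.
apply: filter_forall => i; apply: filter_forall => j.
exact: Fc (xP i j).
Qed.

Lemma continuous_dotv_self p : continuous (fun v : 'cV[R]_p => dotv v v).
Proof.
under eq_fun do rewrite dotvE; apply: continuous_sum => i.
by apply: continuous_mul; exact: coord_continuous.
Qed.

Lemma compact_unit_sphere p : compact [set v : 'cV[R]_p | dotv v v = 1].
Proof.
pose A := [set v : 'rV[R]_p | dotv v^T v^T = 1].
have trc : continuous (fun v : 'rV[R]_p => v^T).
  by apply: continuous_to_mx => i j; under eq_fun do rewrite mxE;
    exact: coord_continuous.
have -> : [set v : 'cV[R]_p | dotv v v = 1] = trmx @` A.
  apply/seteqP; split=> [v v1|_ [v v1 <-] //].
  by exists v^T; rewrite /A /= ?trmxK.
apply: continuous_compact; first exact: continuous_subspaceT.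
apply: bounded_closed_compact.
  apply: bounded_unit_rV => v i Av.
  have := norm2_coord v^T i; rewrite mxE => /le_trans; apply.
  by rewrite /norm2 Av sqrtr1.
apply: (@preimage_closed _ _ (fun v : 'rV[R]_p => dotv v^T v^T) [set x | x = 1]).
  move=> v _; apply: (@continuous_comp _ _ _ trmx (fun v : 'cV[R]_p => dotv v v)).
    exact: trc.
  exact: continuous_dotv_self.
exact: (@closed_eq R 1).
Qed.

(** A minimizer of the Rayleigh quotient over the unit sphere is an
    eigenvector. *)
Lemma symmetric_eigenvalue p (M : 'M[R]_p) : (0 < p)%N -> M^T = M ->
  exists a, eigenvalue M a.
Proof.
move=> p0 Ms; pose f (v : 'cV[R]_p) : R := dotv v (M *m v).
have fc : continuous f.
  rewrite /f; under eq_fun do rewrite dotvE.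
  apply: continuous_sum => i; apply: continuous_mul; first exact: coord_continuous.
  under eq_fun do rewrite mxE; apply: continuous_sum => j.
  by apply: continuous_mul; [exact: cst_continuous|exact: coord_continuous].
have A0 : [set v : 'cV[R]_p | dotv v v = 1] !=set0.
  by exists (delta_mx (Ordinal p0) 0); rewrite /= dotv_delta mxE !eqxx.
have [c cA cmin] := compact_EVT_min A0 (@compact_unit_sphere p)
  (continuous_subspaceT fc).
move: cA; rewrite inE /= => c1.
pose a := f c; exists a; apply/eigenvalueP; exists c^T; last first.
  rewrite trmx_eq0; apply/eqP => c0; move: c1; rewrite c0 dotv0r => /eqP.
  by rewrite eq_sym oner_eq0.
have Nsym : (M - a%:M)^T = M - a%:M by rewrite linearB /= Ms tr_scalar_mx.
have NE u : dotv u ((M - a%:M) *m u) = dotv u (M *m u) - a * dotv u u.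
  by rewrite mulmxBl dotvDr dotvNr mul_scalar_mx dotvZr.
have : (M - a%:M) *m c = 0.
  apply: psd_ker => // [u|]; last by rewrite NE c1 mulr1 subrr.
  rewrite NE subr_ge0; have [->|u0] := eqVneq u 0.
    by rewrite mulmx0 !dotv0r mulr0.
  have nu : 0 < norm2 u by rewrite norm2_gt0.
  have wA : (norm2 u)^-1 *: u \in [set v : 'cV[R]_p | dotv v v = 1].
    rewrite inE /= !dotvZl !dotvZr -norm2_sqr.
    by field; rewrite gt_eqF.
  have := cmin _ wA; rewrite -/a /f -scalemxAr !dotvZl !dotvZr.
  move=> /(ler_wpM2r (sqr_ge0 (norm2 u))); rewrite norm2_sqr => /le_trans; apply.
  rewrite -norm2_sqr le_eqVlt; apply/orP; left; apply/eqP.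
  by field; rewrite gt_eqF.
move/(congr1 trmx); rewrite trmx_mul Nsym trmx0 mulmxBr mul_mx_scalar.
by move/eqP; rewrite subr_eq0 => /eqP.
Qed.

(** The lower bound on the eigenvalues alone is not enough: the infimum of an
    empty set of singular values would be zero. *)
Lemma least_singular_value_gt0 p q (G : 'M[R]_(p, q)) (xi : R) : (0 < p)%N ->
  0 < xi -> (forall u, 0 <= dotv u ((G *m G^T - xi%:M) *m u)) ->
  0 < least_singular_value G.
Proof.
move=> p0 xi0 Gxi.
have xi_le a : eigenvalue (G *m G^T) a -> xi <= a.
  move=> /eigenvalueP[v vE v0].
  have := Gxi v^T; rewrite mulmxBl dotvDr dotvNr.
  have -> : G *m G^T *m v^T = a *: v^T.
    have Gs : (G *m G^T)^T = G *m G^T by rewrite trmx_mul trmxK.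
    by rewrite -Gs -trmx_mul vE linearZ.
  rewrite mul_scalar_mx !dotvZr -mulrBl pmulr_lge0 ?subr_ge0//.
  by rewrite lt_def dotv_ge0 dotv_eq0 andbT trmx_eq0.
apply: (@lt_le_trans _ _ (Num.sqrt xi)); first by rewrite sqrtr_gt0.
have [a Ga] : exists a, eigenvalue (G *m G^T) a.
  by apply: symmetric_eigenvalue => //; rewrite trmx_mul trmxK.
apply: lb_le_inf.
  exists (Num.sqrt a); split; first exact: sqrtr_ge0.
  by rewrite sqr_sqrtr// (le_trans (ltW xi0))// xi_le.
move=> s [s0 /xi_le]; rewrite -{1}(sqr_sqrtr (ltW xi0)).
by rewrite ler_pXn2r// nnegrE// sqrtr_ge0.
Qed.

End LeastSingularValue.

(** * Estimates for the Newton system *)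

Section SaddlePoint.
Context {R : realType} {n m : nat}.

Section FixedMatrices.
Variables (xiG xiB U : R) (B : 'M[R]_n) (G : 'M[R]_(m, n)).
Hypotheses (xiG_gt0 : 0 < xiG) (xiB_gt0 : 0 < xiB) (U_gt0 : 0 < U).
Hypothesis G_free : row_free G.
Hypothesis G_lower : forall u, 0 <= dotv u ((G *m G^T - xiG%:M) *m u).
Hypothesis B_ker : forall u, G *m u = 0 ->
  xiB * norm2 u ^+ 2 <= dotv u (B *m u).
Hypothesis B_le : opnorm B <= U.

Lemma norm2_trmx_lower l : Num.sqrt xiG * norm2 l <= norm2 (G^T *m l).
Proof.
rewrite -(ler_pXn2r (_ : 0 < 2)%N) ?nnegrE ?mulr_ge0 ?norm2_ge0 ?sqrtr_ge0//.
rewrite exprMn (sqr_sqrtr (ltW xiG_gt0)) !norm2_sqr.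
have := G_lower l; rewrite mulmxBl dotvDr dotvNr mul_scalar_mx dotvZr subr_ge0.
by rewrite -mulmxA [dotv l (G *m _)]dotv_mulmx.
Qed.

(** The normal part [v] of [x] is its projection onto the range of [G^T]. *)
Lemma kernel_decomposition x : exists u v,
  [/\ x = u + v, G *m u = 0 & Num.sqrt xiG * norm2 v <= norm2 (G *m x)].
Proof.
have GGu := row_free_mul_tr G_free.
pose w := invmx (G *m G^T) *m (G *m x); pose v := G^T *m w.
have Gv : G *m v = G *m x by rewrite /v /w !mulmxA mulmxV// mul1mx.
exists (x - v), v; split; first by rewrite subrK.
  by rewrite mulmxBr Gv subrr.
have [->|v0] := eqVneq v 0; first by rewrite norm20 mulr0 norm2_ge0.
rewrite -(ler_pM2r (_ : 0 < norm2 v)) ?norm2_gt0// -mulrA -expr2 norm2_sqr.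
have -> : dotv v v = dotv w (G *m x).
  by rewrite {2}/v dotv_mulmx trmxK Gv dotvC.
apply: le_trans (_ : Num.sqrt xiG * (norm2 w * norm2 (G *m x)) <= _).
  by rewrite ler_wpM2l ?sqrtr_ge0 ?dotv_le.
by rewrite mulrA mulrC ler_wpM2l ?norm2_ge0// norm2_trmx_lower.
Qed.

Lemma norm2_hess_le u : norm2 (B *m u) <= U * norm2 u.
Proof.
apply: le_trans (norm2_mulmx B u) _.
by rewrite ler_wpM2r ?norm2_ge0.
Qed.

End FixedMatrices.

Lemma mul_newton_mx (B : 'M[R]_n) (G : 'M[R]_(m, n)) (x : 'cV[R]_n) (l : 'cV[R]_m) :
  newton_mx B G *m col_mx x l = col_mx (B *m x + G^T *m l) (G *m x).
Proof. by rewrite /newton_mx mul_block_col mul0mx addr0. Qed.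

(** Uniform invertibility of the Newton matrix: on the kernel of [G] coercivity
    of [B] controls the tangential part of the solution, the lower bound on
    [G *m G^T] its normal part, and then the multiplier. *)
Lemma newton_mx_lower (xiG xiB U : R) : 0 < xiG -> 0 < xiB -> 0 < U ->
  exists2 C, 0 < C & forall (B : 'M[R]_n) (G : 'M[R]_(m, n)),
    row_free G -> (forall u, 0 <= dotv u ((G *m G^T - xiG%:M) *m u)) ->
    (forall u, G *m u = 0 -> xiB * norm2 u ^+ 2 <= dotv u (B *m u)) ->
    opnorm B <= U ->
    forall y, norm2 y <= C * norm2 (newton_mx B G *m y).
Proof.
move=> xiG0 xiB0 U0.
pose sG : R := Num.sqrt xiG; have sG0 : 0 < sG by rewrite sqrtr_gt0.
pose c1 := (1 + U / sG) / xiB; pose c2 := sG^-1 + c1.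
have c10 : 0 < c1 by rewrite divr_gt0 ?addr_gt0 ?divr_gt0.
have c20 : 0 < c2 by rewrite addr_gt0 ?invr_gt0.
exists (c2 + (1 + U * c2) / sG).
  by rewrite addr_gt0// divr_gt0// addr_gt0// mulr_gt0.
move=> B G Gf Gl Bk BU y; rewrite -[y]vsubmxK mul_newton_mx.
set x := usubmx y; set l := dsubmx y.
set a := B *m x + _; set b := G *m x; set r := norm2 (col_mx a b).
have ar : norm2 a <= r by exact: norm2_col_mxl.
have br : norm2 b <= r by exact: norm2_col_mxr.
have r0 : 0 <= r by exact: norm2_ge0.
have [u [v [xE Gu vb]]] := kernel_decomposition xiG0 Gf Gl x.
have vr : norm2 v <= sG^-1 * r.
  by rewrite mulrC ler_pdivlMr// mulrC; exact: le_trans vb br.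
have ur : norm2 u <= c1 * r.
  have [->|u0] := eqVneq u 0; first by rewrite norm20 mulr_ge0// ltW.
  have nu : 0 < norm2 u by rewrite norm2_gt0.
  have aE : B *m u = a - B *m v - G^T *m l.
    by rewrite /a xE mulmxDr; apply/matrixP => i j; rewrite !mxE; ring.
  have h : xiB * norm2 u ^+ 2 <= norm2 u * ((1 + U / sG) * r).
    apply: le_trans (Bk _ Gu) _.
    rewrite aE (dotvDr u (a - _)) (dotvDr u a) !dotvNr.
    rewrite [dotv u (G^T *m l)]dotv_mulmx trmxK Gu dotv0l subr0.
    have h1 := dotv_le u a; have h2 := dotv_le u (- (B *m v)).
    rewrite dotvNr norm2N in h2; apply: le_trans (lerD h1 h2) _.
    rewrite -mulrDr ler_wpM2l ?norm2_ge0//.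
    rewrite [leRHS]mulrDl mul1r lerD//; apply: le_trans (norm2_hess_le BU v) _.
    by rewrite -mulrA ler_wpM2l// ltW.
  move: h; rewrite expr2 mulrCA ler_pM2l// => h.
  by rewrite /c1 mulrAC ler_pdivlMr// mulrC.
have xr : norm2 x <= c2 * r.
  rewrite xE; apply: le_trans (norm2D _ _) _.
  by rewrite /c2 mulrDl addrC lerD.
have lr : norm2 l <= (1 + U * c2) / sG * r.
  rewrite mulrAC ler_pdivlMr// mulrC.
  apply: le_trans (norm2_trmx_lower xiG0 Gl l) _.
  have -> : G^T *m l = a - B *m x by rewrite /a addrC addKr.
  apply: le_trans (norm2B _ _) _; rewrite mulrDl mul1r lerD//.
  apply: le_trans (norm2_hess_le BU x) _.
  by rewrite -mulrA ler_wpM2l// ltW.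
by apply: le_trans (norm2_col_mx_le _ _) _; rewrite mulrDl lerD.
Qed.

(** The exact Newton direction decreases the augmented Lagrangian: the terms
    in the tangential step and in the dual residual are negative for small
    [eta2], and Young's inequality moves all others into the multiple of the
    squared constraint violation, which [eta1] of order [1 / eta2] absorbs. *)
Lemma exact_descent (xiG xiB U W : R) :
  0 < xiG -> 0 < xiB -> 0 < U -> 0 <= W ->
  exists2 K, 0 < K & forall (B H : 'M[R]_n) (G : 'M[R]_(m, n)) (eta1 eta2 : R),
    row_free G -> (forall u, 0 <= dotv u ((G *m G^T - xiG%:M) *m u)) ->
    (forall u, G *m u = 0 -> xiB * norm2 u ^+ 2 <= dotv u (B *m u)) ->
    opnorm B <= U -> B^T = B -> frobenius H <= W ->
    0 < eta2 -> K * eta2 <= 1 -> K <= eta1 * eta2 ->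
    forall x l a c, B *m x + G^T *m l = - a -> G *m x = - c ->
    dotv a x + dotv c l + eta1 * dotv c (G *m x)
      + eta2 * dotv a (H *m x + G^T *m l)
    <= - (3 / 4 * eta2 * (norm2 a ^+ 2 + norm2 c ^+ 2)).
Proof.
move=> xiG0 xiB0 U0 W0.
pose sG : R := Num.sqrt xiG; have sG0 : 0 < sG by rewrite sqrtr_gt0.
pose k := sG^-1; have k0 : 0 < k by rewrite invr_gt0.
have [xiB0' U0' k0'] : [/\ 0 <= xiB, 0 <= U & 0 <= k] by split; exact: ltW.
pose V := W + U; have V0 : 0 < V by rewrite ltr_wpDl.
have V0' := ltW V0.
pose i := xiB^-1; have i0 : 0 < i by rewrite invr_gt0.
have i0' := ltW i0.
have ie : xiB * i = 1 by rewrite mulfV// gt_eqF.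
pose K := 1 + 6 * V ^+ 2 * i
  + (3 * U * k ^+ 2 + 8 * U ^+ 2 * k ^+ 2 * i + 12 * k ^+ 2 + 3 * V ^+ 2 * k ^+ 2).
have K1 : 0 <= 6 * V ^+ 2 * i.
  by rewrite !mulr_ge0 ?sqr_ge0//.
have K2 : 0 <= 3 * U * k ^+ 2 by rewrite !mulr_ge0 ?sqr_ge0//.
have K3 : 0 <= 8 * U ^+ 2 * k ^+ 2 * i by rewrite !mulr_ge0 ?sqr_ge0//.
have K4 : 0 <= 12 * k ^+ 2 by rewrite !mulr_ge0 ?sqr_ge0//.
have K5 : 0 <= 3 * V ^+ 2 * k ^+ 2 by rewrite !mulr_ge0 ?sqr_ge0//.
exists K; first by rewrite /K; lra.
move=> B H G eta1 eta2 Gf Gl Bk BU Bs HW e20 e2s e12 x l a c xa xc.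
have e20' := ltW e20.
have [u [v [xE Gu vb]]] := kernel_decomposition xiG0 Gf Gl x.
set p := norm2 a; set q := norm2 c; set s := norm2 u; set t := norm2 v.
have [p0 q0 s0 t0] : [/\ 0 <= p, 0 <= q, 0 <= s & 0 <= t].
  by split; exact: norm2_ge0.
have tq : t <= k * q.
  by rewrite /k mulrC ler_pdivlMr// mulrC; move: vb; rewrite xc norm2N.
have xst : norm2 x <= s + t by rewrite xE; exact: norm2D.
have Gtl : G^T *m l = - a - B *m x by rewrite -xa addrC addKr.
have lq : norm2 l <= k * (p + U * (s + t)).
  rewrite /k mulrC ler_pdivlMr// mulrC; apply: le_trans (norm2_trmx_lower xiG0 Gl l) _.
  rewrite Gtl; apply: le_trans (norm2B _ _) _; rewrite norm2N lerD//.
  apply: le_trans (norm2_hess_le BU x) _; rewrite ler_wpM2l//.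
have ax : dotv a x = - dotv x (B *m x) + dotv c l.
  have -> : a = - (B *m x) - G^T *m l by rewrite Gtl opprB addKr opprK.
  rewrite dotvDl !dotvNl [dotv (B *m x) x]dotvC [dotv (G^T *m l) x]dotvC.
  by rewrite [dotv x (G^T *m l)]dotv_mulmx trmxK xc dotvNl opprK.
have xBx : - dotv x (B *m x) <= - (xiB * s ^+ 2) + 2 * (U * s * t) + U * t ^+ 2.
  rewrite xE mulmxDr !dotvDr !dotvDl.
  have -> : dotv v (B *m u) = dotv u (B *m v) by rewrite dotv_mulmx Bs dotvC.
  have h1 := Bk _ Gu; rewrite -/s in h1.
  have h2 := dotv_le (- u) (B *m v); rewrite norm2N dotvNl -/s in h2.
  have h3 := dotv_le (- v) (B *m v); rewrite norm2N dotvNl -/t in h3.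
  have h4 := norm2_hess_le BU v; rewrite -/t in h4.
  have h5 := ler_wpM2l s0 h4; have h6 := ler_wpM2l t0 h4.
  have : - dotv u (B *m v) <= U * s * t by apply: le_trans h2 _; lra.
  have : - dotv v (B *m v) <= U * t ^+ 2 by apply: le_trans h3 _; lra.
  lra.
have cl : dotv c l <= q * (k * (p + U * (s + t))).
  by apply: le_trans (dotv_le _ _) _; rewrite ler_wpM2l.
have aHB : dotv a (H *m x + G^T *m l) <= - p ^+ 2 + p * (V * (s + t)).
  have -> : H *m x + G^T *m l = - a + (H *m x - B *m x).
    by rewrite Gtl; apply/matrixP => i' j'; rewrite !mxE; ring.
  rewrite dotvDr dotvNr -norm2_sqr lerD2l.
  apply: le_trans (dotv_le _ _) _; rewrite ler_wpM2l//.
  apply: le_trans (norm2B _ _) _; rewrite mulrDl lerD//.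
    apply: le_trans (norm2_mulmx_frobenius _ _) _.
    by apply: ler_pM => //; [exact: frobenius_ge0|exact: norm2_ge0].
  apply: le_trans (norm2_hess_le BU x) _; rewrite ler_wpM2l//.
rewrite ax xc dotvNr -norm2_sqr -/q.
have aHB' := ler_wpM2l (ltW e20) aHB.
(* The normal step is at most k * q, so that only p, q and s remain. *)
have st : U * s * t <= U * s * (k * q).
  by rewrite ler_wpM2l// mulr_ge0//.
have tt : U * t ^+ 2 <= U * (k * q) ^+ 2.
  by rewrite ler_wpM2l // ler_pXn2r// nnegrE// mulr_ge0//.
have qt : q * (k * (p + U * (s + t))) <= q * (k * (p + U * (s + k * q))).
  rewrite ler_wpM2l// ler_wpM2l // lerD2l ler_wpM2l //.
  by rewrite lerD2l.
have pt : eta2 * (p * (V * (s + t))) <= eta2 * (p * (V * (s + k * q))).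
  rewrite ler_wpM2l // ler_wpM2l// ler_wpM2l //.
  by rewrite lerD2l.
(* Young: each cross product costs a fraction of xiB * s ^+ 2 or of
   eta2 * p ^+ 2, and a multiple of q ^+ 2. *)
have y1 : 4 * (U * s * (k * q)) <= xiB / 2 * s ^+ 2 + 8 * U ^+ 2 * k ^+ 2 * i * q ^+ 2.
  have h : 0 <= i / 2 * (xiB * s - 4 * U * k * q) ^+ 2 by rewrite mulr_ge0 ?sqr_ge0 ?divr_ge0 ?ltW.
  have E : i / 2 * (xiB * s - 4 * U * k * q) ^+ 2 =
    (xiB * i) * xiB / 2 * s ^+ 2 + 8 * U ^+ 2 * k ^+ 2 * i * q ^+ 2 - (xiB * i) * 4 * (U * s * (k * q)).
    by field.
  rewrite E ie in h; lra.
pose e := eta2^-1; have e0 : 0 < e by rewrite invr_gt0.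
have e0' := ltW e0.
have ee : eta2 * e = 1 by rewrite mulfV// gt_eqF.
have y2 : 2 * (q * (k * p)) <= eta2 / 12 * p ^+ 2 + 12 * k ^+ 2 * e * q ^+ 2.
  have h : 0 <= e / 12 * (eta2 * p - 12 * k * q) ^+ 2 by rewrite mulr_ge0 ?sqr_ge0 ?divr_ge0 ?ltW.
  have E : e / 12 * (eta2 * p - 12 * k * q) ^+ 2 =
    (eta2 * e) * eta2 / 12 * p ^+ 2 + 12 * k ^+ 2 * e * q ^+ 2 - (eta2 * e) * 2 * (q * (k * p)).
    by field.
  rewrite E ee in h; lra.
have y3 : eta2 * (p * (V * s)) <= eta2 / 12 * p ^+ 2 + eta2 * (3 * V ^+ 2 * s ^+ 2).
  have h : 0 <= eta2 / 12 * (p - 6 * V * s) ^+ 2 by rewrite mulr_ge0 ?sqr_ge0 ?divr_ge0 ?ltW.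
  have E : eta2 / 12 * (p - 6 * V * s) ^+ 2 = eta2 / 12 * p ^+ 2 + eta2 * (3 * V ^+ 2 * s ^+ 2)
    - eta2 * (p * (V * s)) by field.
  rewrite E in h; lra.
have y4 : eta2 * (p * (V * (k * q))) <= eta2 / 12 * p ^+ 2 + eta2 * (3 * V ^+ 2 * k ^+ 2 * q ^+ 2).
  have h : 0 <= eta2 / 12 * (p - 6 * V * (k * q)) ^+ 2 by rewrite mulr_ge0 ?sqr_ge0 ?divr_ge0 ?ltW.
  have E : eta2 / 12 * (p - 6 * V * (k * q)) ^+ 2 = eta2 / 12 * p ^+ 2 + eta2 * (3 * V ^+ 2 * k ^+ 2 * q ^+ 2)
    - eta2 * (p * (V * (k * q))) by field.
  rewrite E in h; lra.
(* Coercivity absorbs the s ^+ 2 terms when eta2 is small, and eta1 absorbs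
   the q ^+ 2 terms, of which the largest is of order e = 1 / eta2. *)
have small : eta2 * (3 * V ^+ 2 * s ^+ 2) <= xiB / 2 * s ^+ 2.
  have h : 6 * V ^+ 2 * i * eta2 <= 1.
    apply: le_trans e2s; rewrite ler_wpM2r //; rewrite /K; lra.
  have h2 := ler_wpM2r (ltW xiB0) h.
  have E : 6 * V ^+ 2 * i * eta2 * xiB = (xiB * i) * (6 * V ^+ 2 * eta2) by ring.
  rewrite E ie !mul1r in h2.
  have := ler_wpM2r (sqr_ge0 s) h2; lra.
have e21 : eta2 <= 1.
  apply: le_trans e2s; rewrite ler_peMl // /K; lra.
have large : 3 * U * k ^+ 2 + 8 * U ^+ 2 * k ^+ 2 * i + 12 * k ^+ 2 * e
    + eta2 * (3 * V ^+ 2 * k ^+ 2) + 3 / 4 * eta2 <= eta1.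
  have h := ler_wpM2l (ltW e0) e12.
  have E : e * (eta1 * eta2) = (eta2 * e) * eta1 by ring.
  rewrite E ee mul1r in h; apply: le_trans h.
  have e1 : 1 <= e by rewrite invf_ge1.
  have g1 := ler_wpM2r K2 e1; have g2 := ler_wpM2r K3 e1.
  have e2e : eta2 <= e by exact: le_trans e21 e1.
  have g3 := ler_wpM2r K5 e2e; have g4 := ler_wpM2r K1 (ltW e0).
  rewrite mul0r in g4.
  rewrite /K; lra.
have large' := ler_wpM2r (sqr_ge0 q) large.
lra.
Qed.

End SaddlePoint.

(** * Derivatives of the augmented Lagrangian *)

Section DirectionalDerivatives.
Context {R : realType}.

(** A plain synonym: as a class, [is_derive] would let instance resolution
    choose the derivative of a subterm. *)
Definition has_slope (V : normedModType R) (x v : V) (f : V -> R) (df : R) :=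
  is_derive x v f df.

Lemma continuous_usubmx p q : continuous (@usubmx R p q 1).
Proof.
apply: continuous_to_mx => i j.
under eq_fun do rewrite mxE; exact: coord_continuous.
Qed.

Section Rules.
Variables (V : normedModType R) (x v : V).

(** On the real line, a linear change of variables leaves the difference
    quotients unchanged. *)
Lemma has_slope_line (f : V -> R) df :
  has_slope x v f df <-> has_slope (0 : R) 1 (fun h => f (h *: v + x)) df.
Proof.
have E : (fun h : R => h^-1 *: ((f \o shift x) (h *: v) - f x)) =
  (fun h : R => h^-1 *: (((fun h => f (h *: v + x)) \o shift 0) (h *: 1) -
     (fun h => f (h *: v + x)) 0)).
  by apply/funext => h /=; rewrite addr0 scale0r add0r [_%:A]mulr1.
split=> -[d1 d2]; apply: DeriveDef.
- by move: d1; rewrite /derivable E.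
- by rewrite -d2 /derive E.
- by rewrite /derivable E.
- by rewrite -d2 /derive E.
Qed.

Lemma has_slope_add (f g : V -> R) df dg : has_slope x v f df ->
  has_slope x v g dg -> has_slope x v (fun y => f y + g y) (df + dg).
Proof. by move=> hf hg; exact: (is_deriveD hf hg). Qed.

Lemma has_slope_mul (f g : V -> R) df dg : has_slope x v f df ->
  has_slope x v g dg ->
  has_slope x v (fun y => f y * g y) (f x * dg + g x * df).
Proof. by move=> hf hg; exact: (is_deriveM hf hg). Qed.

Lemma has_slope_scale k (f : V -> R) df : has_slope x v f df ->
  has_slope x v (fun y => k * f y) (k * df).
Proof. by move=> hf; exact: (is_deriveZ k hf). Qed.

Lemma has_slope_bigsum p (h : 'I_p -> V -> R) dh :
  (forall i, has_slope x v (h i) (dh i)) ->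
  has_slope x v (fun y => \sum_i h i y) (\sum_i dh i).
Proof. by move=> hh; have := is_derive_sum hh; rewrite fct_sumE. Qed.

End Rules.

Lemma has_slope_coord p (x v : 'cV[R]_p) i :
  has_slope x v (fun y : 'cV[R]_p => y i 0) (v i 0).
Proof.
apply/has_slope_line.
under eq_fun do rewrite !mxE mulrC.
rewrite -[v i 0 in X in has_slope _ _ _ X]mulr1 -[X in has_slope _ _ _ X]addr0.
apply: has_slope_add; last exact: is_derive_cst.
by apply: has_slope_scale; exact: is_derive_id.
Qed.

Lemma has_slope_usubmx p q (g : 'cV[R]_p -> R) (z v : 'cV[R]_(p + q)) dg :
  has_slope (usubmx z) (usubmx v) g dg ->
  has_slope z v (fun y => g (usubmx y)) dg.
Proof.
move/has_slope_line => h; apply/has_slope_line.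
by under eq_fun do rewrite linearD linearZ.
Qed.

Lemma has_slope_dsubmx p q (g : 'cV[R]_q -> R) (z v : 'cV[R]_(p + q)) dg :
  has_slope (dsubmx z) (dsubmx v) g dg ->
  has_slope z v (fun y => g (dsubmx y)) dg.
Proof.
move/has_slope_line => h; apply/has_slope_line.
by under eq_fun do rewrite linearD linearZ.
Qed.

Lemma has_slope_gradient p (g : 'cV[R]_p -> R) x v : differentiable g x ->
  has_slope x v g (dotv (gradient g x) v).
Proof.
move=> dg; have -> : dotv (gradient g x) v = 'D_v g x.
  rewrite deriveE// [in RHS](matrix_sum_delta v) linear_sum dotvE.
  apply: eq_bigr => i _; rewrite linear_sum big_ord1 linearZ /= mxE deriveE//.
  by rewrite mulrC.
by apply: derivableP; exact: diff_derivable.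
Qed.

Lemma gradientE p (g : 'cV[R]_p -> R) x w :
  (forall v, has_slope x v g (dotv w v)) -> gradient g x = w.
Proof.
by move=> h; apply/colP => i; rewrite mxE (@derive_val _ _ _ _ _ _ _ (h _)) dotv_delta.
Qed.

Lemma hessianE p (g : 'cV[R]_p -> R) x i w :
  (forall v, has_slope x v (fun y => gradient g y i 0) (dotv w v)) ->
  forall j, hessian g x i j = w j 0.
Proof.
move=> h j; rewrite /hessian mxE.
by rewrite (@derive_val _ _ _ _ _ _ _ (h (delta_mx j 0))) dotv_delta.
Qed.

Lemma dotv_row p q (A : 'M[R]_(p, q)) i v : dotv (row i A)^T v = (A *m v) i 0.
Proof. by rewrite dotvE mxE; apply: eq_bigr => j _; rewrite !mxE. Qed.

Lemma jac_gradient p q (c : 'cV[R]_p -> 'cV[R]_q) x i j :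
  jac c x i j = gradient (fun y => c y i 0) x j 0.
Proof. by rewrite !mxE. Qed.

Lemma jac_row p q (c : 'cV[R]_p -> 'cV[R]_q) x i v :
  (jac c x *m v) i 0 = dotv (gradient (fun y => c y i 0) x) v.
Proof. by rewrite dotvE mxE; apply: eq_bigr => j _; rewrite jac_gradient. Qed.

Section SecondOrder.
Variables (p : nat) (g : 'cV[R]_p -> R).
Hypothesis g_C2 : twice_continuously_differentiable g.

Lemma C2_has_slope x v : has_slope x v g (dotv (gradient g x) v).
Proof. by case: g_C2 => dg _ _; exact: has_slope_gradient. Qed.

Lemma C2_has_slope_gradient x v i :
  has_slope x v (fun y => gradient g y i 0) ((hessian g x *m v) i 0).
Proof.
have dgi : differentiable (fun y => gradient g y i 0) x.
  apply: (@differentiable_comp _ _ _ _ (gradient g)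
    (fun M : 'cV[R]_p => M i 0)); first by case: g_C2.
  exact: differentiable_coord.
by have := has_slope_gradient v dgi; rewrite -jac_row.
Qed.

Lemma C2_continuous : continuous g.
Proof.
by case: g_C2 => dg _ _ x; exact: differentiable_continuous.
Qed.

Lemma C2_continuous_gradient i : continuous (fun x => gradient g x i 0).
Proof.
case: g_C2 => _ dg _ x.
apply: (@continuous_comp _ _ _ (gradient g) (fun M : 'cV[R]_p => M i 0)).
  exact: differentiable_continuous.
exact: coord_continuous.
Qed.

Lemma C2_continuous_hessian i j : continuous (fun x => hessian g x i j).
Proof.
case: g_C2 => _ _ hc x.
apply: (@continuous_comp _ _ _ (hessian g) (fun M : 'M[R]_p => M i j)).
  exact: hc.
exact: coord_continuous.
Qed.

End SecondOrder.

End DirectionalDerivatives.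

Lemma addr_congr (V : zmodType) (x x' y y' : V) :
  x = x' -> y = y' -> x + y = x' + y'.
Proof. by move=> -> ->. Qed.

Section AugmentedLagrangian.
Context {R : realType} {n m : nat}.

(* Unification diverges if it unfolds these matrices of limits. *)
Local Opaque gradient jac hessian.

Variables (f : 'cV[R]_n -> R) (c : 'cV[R]_n -> 'cV[R]_m).
Hypothesis f_C2 : twice_continuously_differentiable f.
Hypothesis c_C2 : forall i, twice_continuously_differentiable (fun x => c x i 0).

Let ci i (x : 'cV[R]_n) : R := c x i 0.

Lemma grad_x_lagrangianE x l j : grad_x_lagrangian f c x l j 0 =
  gradient f x j 0 + \sum_i l i 0 * gradient (ci i) x j 0.
Proof.
pose w := gradient f x + \sum_i l i 0 *: gradient (ci i) x.
rewrite /grad_x_lagrangian (@gradientE _ _ _ _ w); last first.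
  move=> v; rewrite /w dotvDl dotv_suml.
  apply: has_slope_add; first exact: C2_has_slope.
  under eq_fun do rewrite dotvE; apply: has_slope_bigsum => i.
  by rewrite dotvZl; apply: has_slope_scale; exact: (C2_has_slope (c_C2 i)).
by rewrite /w !mxE summxE; apply: addr_congr => //; apply: eq_bigr => i _; rewrite !mxE.
Qed.

Lemma has_slope_grad_x_lagrangian x v l j :
  has_slope x v (fun y => grad_x_lagrangian f c y l j 0)
    ((hessian f x *m v) j 0 + \sum_i l i 0 * (hessian (ci i) x *m v) j 0).
Proof.
under eq_fun do rewrite grad_x_lagrangianE.
apply: has_slope_add; first exact: (C2_has_slope_gradient f_C2).
by apply: has_slope_bigsum => i; apply: has_slope_scale; exact: (C2_has_slope_gradient (c_C2 i)).
Qed.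

Lemma hess_x_lagrangianE x l i j : hess_x_lagrangian f c x l i j =
  hessian f x i j + \sum_k l k 0 * hessian (ci k) x i j.
Proof.
pose w := (row i (hessian f x))^T + \sum_k l k 0 *: (row i (hessian (ci k) x))^T.
transitivity (w j 0).
  apply: hessianE => v; rewrite /w dotvDl dotv_suml dotv_row.
  under [in X in has_slope _ _ _ X]eq_bigr do rewrite dotvZl dotv_row.
  exact: has_slope_grad_x_lagrangian.
rewrite /w mxE summxE [_^T j 0]mxE [row _ _ _ _]mxE; apply: addr_congr => //.
apply: eq_bigr => k _; by rewrite [LHS]mxE [_^T j 0]mxE [row _ _ _ _]mxE.
Qed.

Lemma hess_x_lagrangian_mul x l (v : 'cV[R]_n) j : (hess_x_lagrangian f c x l *m v) j 0 =
  (hessian f x *m v) j 0 + \sum_i l i 0 * (hessian (ci i) x *m v) j 0.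
Proof.
have -> : hess_x_lagrangian f c x l =
    hessian f x + \sum_i l i 0 *: hessian (ci i) x.
  apply/matrixP => i k; rewrite [RHS]mxE; apply: etrans (hess_x_lagrangianE _ _ _ _) _.
  apply: addr_congr => //.
  by rewrite summxE; apply: eq_bigr => i' _; rewrite [RHS]mxE.
rewrite mulmxDl mxE mulmx_suml summxE; apply: addr_congr => //.
by apply: eq_bigr => i _; rewrite -scalemxAl mxE.
Qed.

Local Opaque grad_x_lagrangian hess_x_lagrangian.

Let a (z : 'cV[R]_(n + m)) := grad_x_lagrangian f c (usubmx z) (dsubmx z).
Let H (z : 'cV[R]_(n + m)) := hess_x_lagrangian f c (usubmx z) (dsubmx z).
Let C (z : 'cV[R]_(n + m)) := c (usubmx z).
Let G (z : 'cV[R]_(n + m)) := jac c (usubmx z).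

Lemma has_slope_C z v i : has_slope z v (fun y => C y i 0) ((G z *m usubmx v) i 0).
Proof.
rewrite /G jac_row; apply: (@has_slope_usubmx _ _ _ (ci i)).
exact: (C2_has_slope (c_C2 i)).
Qed.

Lemma has_slope_a z v j : has_slope z v (fun y => a y j 0)
  ((H z *m usubmx v + (G z)^T *m dsubmx v) j 0).
Proof.
under eq_fun do rewrite /a grad_x_lagrangianE.
have -> : (H z *m usubmx v + (G z)^T *m dsubmx v) j 0 =
  (hessian f (usubmx z) *m usubmx v) j 0 +
  \sum_i (dsubmx z i 0 * (hessian (ci i) (usubmx z) *m usubmx v) j 0 +
         gradient (ci i) (usubmx z) j 0 * dsubmx v i 0).
  rewrite big_split /= addrA -hess_x_lagrangian_mul mxE; apply: addr_congr => //.
  by rewrite mxE; apply: eq_bigr => i _; rewrite mxE jac_gradient.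
apply: has_slope_add; first by exact: (@has_slope_usubmx _ _ _ (fun x => gradient f x j 0) z v _ (C2_has_slope_gradient f_C2 _ _ _)).
apply: has_slope_bigsum => i; apply: has_slope_mul.
  exact: (@has_slope_dsubmx _ _ _ (fun y => y i 0) z v _ (has_slope_coord _ _ _)).
exact: (@has_slope_usubmx _ _ _ (fun y => gradient (ci i) y j 0) z v _ (C2_has_slope_gradient (c_C2 i) _ _ _)).
Qed.

(** The derivative of the augmented Lagrangian along [v]: the derivatives of the
    constraint and of [a] along [v] are [G *m usubmx v] and
    [H *m usubmx v + G^T *m dsubmx v]. *)
Definition aug_slope (eta1 eta2 : R) (z v : 'cV[R]_(n + m)) : R :=
  dotv (a z) (usubmx v) + dotv (C z) (dsubmx v)
  + eta1 * dotv (C z) (G z *m usubmx v)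
  + eta2 * dotv (a z) (H z *m usubmx v + (G z)^T *m dsubmx v).

Lemma has_slope_aug_lagrangian eta1 eta2 z v :
  has_slope z v (aug_lagrangian f c eta1 eta2) (aug_slope eta1 eta2 z v).
Proof.
have sq k p (F : 'cV[R]_(n + m) -> 'cV[R]_p) (dF : 'cV[R]_p) :
    (forall i, has_slope z v (fun y => F y i 0) (dF i 0)) ->
    has_slope z v (fun y => k / 2 * norm2 (F y) ^+ 2) (k * dotv (F z) dF).
  move=> h; under eq_fun do rewrite norm2_sqr dotvE.
  have -> : k * dotv (F z) dF = k / 2 * \sum_i (F z i 0 * dF i 0 + F z i 0 * dF i 0).
    by rewrite dotvE big_split /= -mulr2n -[in RHS]mulr_natl; field.
  by apply: has_slope_scale; apply: has_slope_bigsum => i; exact: has_slope_mul.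
rewrite /aug_slope; apply: has_slope_add; last by apply: sq => i; exact: has_slope_a.
apply: has_slope_add; last by apply: sq => i; exact: has_slope_C.
rewrite /lagrangian; under eq_fun do rewrite dotvE.
have -> : dotv (a z) (usubmx v) + dotv (C z) (dsubmx v) =
    dotv (gradient f (usubmx z)) (usubmx v) +
    \sum_i (dsubmx z i 0 * (G z *m usubmx v) i 0 + C z i 0 * dsubmx v i 0).
  rewrite big_split /= addrA; apply: addr_congr; last exact: dotvE.
  have -> : a z = gradient f (usubmx z) + (G z)^T *m dsubmx z.
    apply/colP => j; apply: etrans (grad_x_lagrangianE _ _ _) _.
    rewrite [RHS]mxE; apply: addr_congr => //; rewrite [RHS]mxE.
    by apply: eq_bigr => i _; rewrite [_^T _ _]mxE jac_gradient mulrC.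
  rewrite dotvDl; apply: addr_congr => //.
  by rewrite -(trmxK (G z)) -dotv_mulmx trmxK dotvE.
apply: has_slope_add; first by exact: (@has_slope_usubmx _ _ _ f z v _ (C2_has_slope f_C2 _ _)).
apply: has_slope_bigsum => i; apply: has_slope_mul; last exact: has_slope_C.
exact: (@has_slope_dsubmx _ _ _ (fun y => y i 0) z v _ (has_slope_coord _ _ _)).
Qed.

Lemma aug_slopeE eta1 eta2 z v :
  dotv (gradient (aug_lagrangian f c eta1 eta2) z) v = aug_slope eta1 eta2 z v.
Proof.
pose w := col_mx (a z + eta1 *: ((G z)^T *m C z) + eta2 *: ((H z)^T *m a z))
  (C z + eta2 *: (G z *m a z)).
have wE v' : aug_slope eta1 eta2 z v' = dotv w v'.
  rewrite -{2}[v']vsubmxK dotv_col_mx !dotvDl !dotvZl /aug_slope !dotvDr.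
  rewrite [dotv (C z) (G z *m _)]dotv_mulmx [dotv (a z) (H z *m _)]dotv_mulmx.
  by rewrite [dotv (a z) ((G z)^T *m _)]dotv_mulmx trmxK; ring.
rewrite (@gradientE _ _ _ _ w) ?wE// => v'; rewrite -wE.
exact: has_slope_aug_lagrangian.
Qed.

Lemma continuous_of_x (h : 'cV[R]_n -> R) : continuous h ->
  continuous (fun z : 'cV[R]_(n + m) => h (usubmx z)).
Proof.
move=> hc z; apply: (@continuous_comp _ _ _ (@usubmx R n m 1) h).
  exact: continuous_usubmx.
exact: hc.
Qed.

Lemma continuous_lambda i : continuous (fun z : 'cV[R]_(n + m) => dsubmx z i 0).
Proof. under eq_fun do rewrite mxE; exact: coord_continuous. Qed.

Lemma continuous_add (T : topologicalType) (F K : T -> R) : continuous F ->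
  continuous K -> continuous (fun x => F x + K x).
Proof. by move=> Fc Kc x; apply: (@continuousD _ _ _ F K); [exact: Fc|exact: Kc]. Qed.

Lemma continuous_scale (T : topologicalType) k (F : T -> R) : continuous F ->
  continuous (fun x => k * F x).
Proof. by move=> Fc; apply: continuous_mul => //; exact: cst_continuous. Qed.

Lemma continuous_grad_x j : continuous (fun z => a z j 0).
Proof.
under eq_fun do rewrite /a grad_x_lagrangianE.
apply: continuous_add.
  by apply: (@continuous_of_x (fun x => gradient f x j 0)); exact: (C2_continuous_gradient f_C2).
apply: continuous_sum => i; apply: continuous_mul; first exact: continuous_lambda.
by apply: (@continuous_of_x (fun x => gradient (ci i) x j 0)); exact: (C2_continuous_gradient (c_C2 i)).
Qed.

Lemma continuous_hess_x i j : continuous (fun z => H z i j).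
Proof.
under eq_fun do rewrite /H hess_x_lagrangianE.
apply: continuous_add.
  by apply: (@continuous_of_x (fun x => hessian f x i j)); exact: (C2_continuous_hessian f_C2).
apply: continuous_sum => k; apply: continuous_mul; first exact: continuous_lambda.
by apply: (@continuous_of_x (fun x => hessian (ci k) x i j)); exact: (C2_continuous_hessian (c_C2 k)).
Qed.

Lemma continuous_constraint i : continuous (fun z => C z i 0).
Proof. by apply: (@continuous_of_x (ci i)); exact: (C2_continuous (c_C2 i)). Qed.

Lemma continuous_jac i j : continuous (fun z => G z i j).
Proof.
under eq_fun do rewrite /G jac_gradient.
by apply: (@continuous_of_x (fun x => gradient (ci i) x j 0)); exact: (C2_continuous_gradient (c_C2 i)).
Qed.

Lemma continuous_kkt_residual i : continuous (fun z => kkt_residual f c z i 0).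
Proof.
rewrite /kkt_residual; under eq_fun do rewrite mxE.
by case: (fintype.split i) => j; [exact: continuous_grad_x|exact: continuous_constraint].
Qed.

Lemma continuous_dotv (T : topologicalType) p (F K : T -> 'cV[R]_p) :
  (forall i, continuous (fun x => F x i 0)) ->
  (forall i, continuous (fun x => K x i 0)) ->
  continuous (fun x => dotv (F x) (K x)).
Proof.
move=> Fc Kc; under eq_fun do rewrite dotvE.
by apply: continuous_sum => i; exact: continuous_mul.
Qed.

Lemma continuous_mulmx_cst (T : topologicalType) p q (F : T -> 'M[R]_(p, q)) (v : 'cV[R]_q) :
  (forall i j, continuous (fun x => F x i j)) ->
  forall i, continuous (fun x => (F x *m v) i 0).
Proof.
move=> Fc i; under eq_fun do rewrite mxE.
by apply: continuous_sum => j; apply: continuous_mul => //; exact: cst_continuous.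
Qed.

Lemma continuous_aug_slope eta1 eta2 v :
  continuous (fun z => aug_slope eta1 eta2 z v).
Proof.
rewrite /aug_slope.
have Gv i : continuous (fun z => (G z *m usubmx v) i 0).
  exact: (continuous_mulmx_cst continuous_jac).
have Hv i : continuous (fun z => (H z *m usubmx v) i 0).
  exact: (continuous_mulmx_cst continuous_hess_x).
have Gtv : forall i, continuous (fun z => ((G z)^T *m dsubmx v) i 0).
  apply: continuous_mulmx_cst => i j; under eq_fun do rewrite mxE.
  exact: continuous_jac.
apply: continuous_add; [apply: continuous_add; [apply: continuous_add|]|].
- apply: continuous_dotv => i; first exact: continuous_grad_x.
  exact: cst_continuous.
- apply: continuous_dotv => i; first exact: continuous_constraint.
  exact: cst_continuous.
- apply: continuous_scale; apply: continuous_dotv => //.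
  exact: continuous_constraint.
- apply: continuous_scale; apply: continuous_dotv => i.
    exact: continuous_grad_x.
  under eq_fun do rewrite mxE; exact: continuous_add.
Qed.

Lemma continuous_aug_lagrangian eta1 eta2 :
  continuous (aug_lagrangian f c eta1 eta2).
Proof.
rewrite /aug_lagrangian; under eq_fun do rewrite !norm2_sqr.
apply: continuous_add; [apply: continuous_add|].
- apply: continuous_add; first by apply: (@continuous_of_x f); exact: (C2_continuous f_C2).
  by apply: continuous_dotv; [exact: continuous_lambda|exact: continuous_constraint].
- by apply: continuous_scale; apply: continuous_dotv; exact: continuous_constraint.
- by apply: continuous_scale; apply: continuous_dotv; exact: continuous_grad_x.
Qed.

End AugmentedLagrangian.

(** * Compactness and short steps of the line search *)

Section Compactness.
Context {R : realType}.

Definition primal_dual_set n m (X : set 'cV[R]_n) (Lambda : set 'cV[R]_m) :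
  set 'cV[R]_(n + m) := [set z | X (usubmx z) /\ Lambda (dsubmx z)].

Lemma compact_primal_dual_set n m (X : set 'cV[R]_n) (Lambda : set 'cV[R]_m) :
  compact X -> compact Lambda -> compact (primal_dual_set X Lambda).
Proof.
move=> Xc Lc; pose g (p : 'cV[R]_n * 'cV[R]_m) := col_mx p.1 p.2.
have gc : continuous g.
  apply: continuous_to_mx => i j; rewrite /g; under eq_fun do rewrite mxE.
  case: (fintype.split i) => k x.
    by apply: (@continuous_comp _ _ _ fst (fun M : 'cV[R]_n => M k j));
      [exact: cvg_fst|exact: coord_continuous].
  by apply: (@continuous_comp _ _ _ snd (fun M : 'cV[R]_m => M k j));
    [exact: cvg_snd|exact: coord_continuous].
have -> : primal_dual_set X Lambda = g @` (X `*` Lambda).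
  apply/seteqP; split=> [z [Xz Lz]|_ [[x l] [/= Xx Ll] <-]].
    by exists (usubmx z, dsubmx z) => //; rewrite /g /= vsubmxK.
  by rewrite /primal_dual_set /= /g /= col_mxKu col_mxKd.
apply: continuous_compact; first exact: continuous_subspaceT.
exact: compact_setX.
Qed.

Variables (p : nat) (K : set 'cV[R]_p).
Hypothesis K_compact : compact K.

Lemma compact_bounded_fun (h : 'cV[R]_p -> R) : continuous h ->
  exists2 M, 0 < M & forall z, K z -> `|h z| <= M.
Proof.
move=> hc; have : compact (h @` K).
  by apply: continuous_compact => //; exact: continuous_subspaceT.
move=> /compact_bounded[M [_ Mh]]; exists (Num.max M 0 + 1).
  by rewrite ltr_wpDl// le_max lexx orbT.
move=> z Kz; apply: Mh; last by exists z.
by rewrite (@le_lt_trans _ _ (Num.max M 0))// ?le_max ?lexx// ltrDl.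
Qed.

(** Uniform continuity at the points of a compact set, the second point being
    free: the trial points of a line search may leave the set. *)
Lemma compact_unif_continuous (h : 'cV[R]_p -> R) e : continuous h -> 0 < e ->
  \forall d \near 0^'+, forall z z', K z -> norm2 (z' - z) < d ->
    `|h z' - h z| < e.
Proof.
move=> hc e0.
pose Q (d : R) z := forall z', norm2 (z' - z) < d -> `|h z' - h z| < e.
suff : \forall d \near 0^'+, K `<=` Q d.
  by apply: filterS => d KQ z z' Kz; exact: KQ.
have /compact_near_coveringP := K_compact; apply => x Kx.
have e2 : 0 < e / 2 by rewrite divr_gt0.
have /cvgrPdist_lt/(_ _ e2)/nbhs_ballP[r /= r0 xr] := hc x.
have r2 : 0 < r / 2 by rewrite divr_gt0.
exists (ball x (r / 2), [set d | d < r / 2]).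
  by split; [exact: nbhsx_ballx|exact: nbhs_right_lt].
move=> [x' d] [/= xx' dr] z' z'x'.
have x'z' : ball x' (r / 2) z'.
  split=> // i j; rewrite (ord1 j) /ball /= distrC.
  apply: le_lt_trans (lt_trans z'x' dr).
  by have := norm2_coord (z' - x') i; rewrite !mxE.
have xz' : ball x r z'.
  by rewrite (splitr r); exact: ball_triangle xx' x'z'.
have xx'r : ball x r x'.
  by apply: le_ball xx'; lra.
have h1 := xr _ xz'; have h2 := xr _ xx'r; rewrite /= in h1 h2.
rewrite (splitr e); apply: le_lt_trans (ltrD h1 h2).
by rewrite [X in _ <= X + _]distrC; exact: ler_distD.
Qed.

End Compactness.

Section Armijo.
Context {R : realType} {n m : nat}.
Variables (f : 'cV[R]_n -> R) (c : 'cV[R]_n -> 'cV[R]_m).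
Hypothesis f_C2 : twice_continuously_differentiable f.
Hypothesis c_C2 : forall i, twice_continuously_differentiable (fun x => c x i 0).

Lemma aug_slope_sum eta1 eta2 z v : aug_slope f c eta1 eta2 z v =
  \sum_i aug_slope f c eta1 eta2 z (delta_mx i 0) * v i 0.
Proof.
rewrite -(aug_slopeE f_C2 c_C2) dotvE; apply: eq_bigr => i _.
by rewrite -(aug_slopeE f_C2 c_C2) dotv_delta.
Qed.

Lemma aug_slopeD eta1 eta2 z v w : aug_slope f c eta1 eta2 z (v + w) =
  aug_slope f c eta1 eta2 z v + aug_slope f c eta1 eta2 z w.
Proof. by rewrite -!(aug_slopeE f_C2 c_C2) dotvDr. Qed.

Lemma aug_lagrangian_MVT eta1 eta2 (z v : 'cV[R]_(n + m)) (t : R) : 0 < t -> exists2 s, 0 < s < t &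
  aug_lagrangian f c eta1 eta2 (z + t *: v) - aug_lagrangian f c eta1 eta2 z
  = t * aug_slope f c eta1 eta2 (z + s *: v) v.
Proof.
move=> t0; pose F (s : R) : R := aug_lagrangian f c eta1 eta2 (z + s *: v).
have dF (s : R) : is_derive s (1 : R) (F : R -> R) (aug_slope f c eta1 eta2 (z + s *: v) v).
  apply/has_slope_line.
  have -> : (fun h : R => F (h *: (1 : R) + s)) =
      (fun h => aug_lagrangian f c eta1 eta2 (h *: v + (z + s *: v))).
    by apply/funext => h; rewrite /F [h%:A]mulr1 scalerDl addrCA.
  exact: (has_slope_line _ _ _ _).1 (has_slope_aug_lagrangian _ _ _ _ _ _).
have [|s] := @MVT R F _ 0 t t0 (fun s _ => dF s).
  apply: continuous_subspaceT => s.
  by apply/differentiable_continuous/derivable1_diffP; case: (dF s).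
rewrite in_itv /= => s0t; rewrite /F scale0r addr0 subr0 mulrC => ->.
by exists s.
Qed.

(** The slope at the intermediate point of the mean value theorem differs from
    the slope at [z] by less than the slack [(1 - beta) * e] as soon as the
    step is short, uniformly over the compact set. *)
Lemma armijo_short_steps (K : set 'cV[R]_(n + m)) eta1 eta2 M e beta :
  compact K -> 0 <= M -> 0 < e -> beta < 1 ->
  exists2 a, 0 < a & forall z v t, K z -> norm2 v <= M ->
    aug_slope f c eta1 eta2 z v <= - e -> 0 < t <= a ->
    aug_lagrangian f c eta1 eta2 (z + t *: v) <=
      aug_lagrangian f c eta1 eta2 z + t * beta * aug_slope f c eta1 eta2 z v.
Proof.
move=> Kc M0 e0 b1.
pose q := (n + m)%:R * M + 1; have q0 : 0 < q.
  by rewrite ltr_wpDl// mulr_ge0.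
pose e' := (1 - beta) * e / q; have e'0 : 0 < e'.
  by rewrite divr_gt0// mulr_gt0// subr_gt0.
have : \forall d \near 0^'+, forall i : 'I_(n + m), forall z z', K z -> norm2 (z' - z) < d ->
    `|aug_slope f c eta1 eta2 z' (delta_mx i 0)
      - aug_slope f c eta1 eta2 z (delta_mx i 0)| < e'.
  apply: filter_forall => i.
  have cs : continuous (fun z => aug_slope f c eta1 eta2 z (delta_mx i 0)).
    exact: continuous_aug_slope.
  exact: (compact_unif_continuous Kc cs e'0).
move=> /(filterI (nbhs_right_gt 0)) /filter_ex[d [d0 hd]].
have M1 : 0 < M + 1 by rewrite ltr_wpDl.
exists (d / (M + 1)); first by rewrite divr_gt0.
move=> z v t Kz vM sl /andP[t0 ta].
have [s /andP[s0 st] E] := aug_lagrangian_MVT eta1 eta2 z v t0.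
rewrite -lerBlDl E -mulrA; apply: ler_wpM2l; first exact: ltW.
have close : norm2 ((z + s *: v) - z) < d.
  rewrite addrC addKr norm2Z gtr0_norm//.
  have : s * norm2 v <= s * M by rewrite ler_wpM2l// ltW.
  move/le_lt_trans; apply; apply: (@lt_le_trans _ _ (t * (M + 1))).
    by rewrite mulrDr mulr1 (le_lt_trans (ler_wpM2r M0 (ltW st)))// ltrDl.
  by rewrite -ler_pdivlMr.
have diff : aug_slope f c eta1 eta2 (z + s *: v) v - aug_slope f c eta1 eta2 z v <=
    e' * ((n + m)%:R * M).
  rewrite (aug_slope_sum _ _ (z + _)) (aug_slope_sum _ _ z) -sumrB.
  rewrite mulrCA -[(n + m)%:R * _]mulrC mulr_natr -[X in _ *+ X]card_ord -sumr_const.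
  apply: ler_sum => i _; rewrite -mulrBl; apply: le_trans (ler_norm _) _.
  rewrite normrM; apply: ler_pM => //; first by apply/ltW/hd.
  exact: le_trans (norm2_coord v i) vM.
have eM : e' * ((n + m)%:R * M) <= (1 - beta) * e.
  rewrite /e' -mulrA ler_piMr//; first by rewrite mulr_ge0 ?subr_ge0 ?ltW.
  by rewrite ler_pdivrMl// mulr1 /q lerDl.
have eS : 0 <= (1 - beta) * (- e - aug_slope f c eta1 eta2 z v).
  by rewrite mulr_ge0// subr_ge0// ltW.
move: diff eM eS; move: (aug_slope _ _ _ _ _ _) (aug_slope _ _ _ _ _ _) => S S'.
move: (e' * _) => r; clear; lra.
Qed.

End Armijo.

(** * One realization of the algorithm *)

Section Bounds.
Context {R : realType}.

Lemma compact_bounded_frobenius p q r (K : set 'cV[R]_p)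
  (F : 'cV[R]_p -> 'M[R]_(q, r)) : compact K ->
  (forall i j, continuous (fun z => F z i j)) ->
  exists2 W, 0 <= W & forall z, K z -> frobenius (F z) <= W.
Proof.
move=> Kc Fc.
have sc : continuous (fun z => \sum_i \sum_j F z i j * F z i j).
  apply: continuous_sum => i; apply: continuous_sum => j.
  exact: continuous_mul.
have [M M0 hM] := compact_bounded_fun Kc sc.
exists (Num.sqrt M); first exact: sqrtr_ge0.
move=> z Kz; apply: ler_wsqrtr; apply: le_trans (hM _ Kz).
by under eq_bigr do under eq_bigr do rewrite expr2; exact: ler_norm.
Qed.

Lemma norm2_frobenius p (v : 'cV[R]_p) : norm2 v = frobenius v.
Proof.
rewrite /norm2 /frobenius dotvE; congr Num.sqrt; apply: eq_bigr => i _.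
by rewrite big_ord1 expr2.
Qed.

Lemma unitmx_lower p (A : 'M[R]_p) C :
  (forall y, norm2 y <= C * norm2 (A *m y)) -> A \in unitmx.
Proof.
move=> h; rewrite -unitmx_tr -row_free_unit -kermx_eq0; apply/eqP/row_matrixP => i.
rewrite row0; set v := row i _.
have Av : A *m v^T = 0.
  apply: trmx_inj; rewrite trmx_mul trmxK trmx0.
  by rewrite /v -row_mul mulmx_ker row0.
apply: trmx_inj; rewrite trmx0; apply/eqP; rewrite -norm2_eq0 eq_le norm2_ge0 andbT.
by have := h v^T; rewrite Av norm20 mulr0.
Qed.

End Bounds.

Section PenaltyRates.
Context {R : realType}.
Implicit Types p q u v r : R.

Lemma slope_terms_le p q u v MG MH : 0 <= p -> 0 <= q -> 0 <= u -> 0 <= v ->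
  0 <= MG -> 0 <= MH ->
  p * q + p * q + u * (p * (MG * q)) + v * (p * (MH * q + MG * q)) <=
  (2 + MG + MH) * (1 + u + v) * p * q.
Proof.
move=> p0 q0 u0 v0 MG0 MH0; rewrite -subr_ge0.
have -> : (2 + MG + MH) * (1 + u + v) * p * q - (p * q + p * q +
    u * (p * (MG * q)) + v * (p * (MH * q + MG * q))) =
    (MG + MH + (2 + MH) * u + 2 * v) * (p * q) by ring.
by rewrite !(mulr_ge0, addr_ge0).
Qed.

(** The left side is of order [N ^ 2 * N ^ -4], the right side of order
    [N ^ -1]. *)
Lemma inexact_error_small (A a b N d : R) : 0 <= A -> 0 < a -> 0 < b -> 1 <= N ->
  d <= (N ^+ 4)^-1 -> 4 * (A * (1 + a + b)) <= b * N ->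
  A * (1 + a * N ^+ 2 + b / N) * d <= b / N / 4.
Proof.
move=> A0 a0 b0 N1 dN AN; have N0 : 0 < N by exact: lt_le_trans N1.
pose I := N^-1; have I0 : 0 < I by rewrite invr_gt0.
have NI : N * I = 1 by rewrite mulfV ?gt_eqF.
have I1 : I <= 1 by rewrite invf_le1.
have In k : I ^+ k <= 1 by rewrite exprn_ile1// ltW.
have S0 : 0 <= 1 + a * N ^+ 2 + b * I.
  by rewrite addr_ge0 ?mulr_ge0 ?addr_ge0 ?mulr_ge0 ?exprn_ge0// ltW.
apply: (@le_trans _ _ (A * (1 + a * N ^+ 2 + b * I) * I ^+ 4)).
  by apply: ler_wpM2l; [exact: mulr_ge0|rewrite /I exprVn].
have -> : A * (1 + a * N ^+ 2 + b * I) * I ^+ 4 =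
    A * (I ^+ 2 + a * (N * I) ^+ 2 + b * I ^+ 3) * I ^+ 2 by ring.
rewrite NI expr1n mulr1.
have h : A * (I ^+ 2 + a + b * I ^+ 3) <= b * N / 4.
  rewrite ler_pdivlMr// mulrC; apply: le_trans AN.
  apply: ler_wpM2l => //; apply: ler_wpM2l => //.
  apply: lerD; first by rewrite lerD2r.
  by apply: ler_piMr => //; exact: ltW.
apply: le_trans (ler_wpM2r (sqr_ge0 I) h) _.
have -> : b * N / 4 * I ^+ 2 = (N * I) * (b * I / 4) by ring.
by rewrite NI mul1r.
Qed.

Lemma descent_margin (e g y Q A : R) : 0 <= A -> 0 <= g -> y <= Q * g ->
  A * Q <= e / 4 ->
  - (3 / 4 * e * g ^+ 2) + A * g * y <= - (e * g ^+ 2 / 2).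
Proof.
move=> A0 g0 yQ AQ.
have h1 := ler_wpM2l (mulr_ge0 A0 g0) yQ.
have h2 := ler_wpM2r (sqr_ge0 g) AQ.
lra.
Qed.

Lemma expr_unbounded (r T : R) : 1 < r -> exists k, T <= r ^+ k.
Proof.
move=> r1; have r0 : 0 < r - 1 by rewrite subr_gt0.
have B k : 1 + k%:R * (r - 1) <= r ^+ k.
  elim: k => [|k IH]; first by rewrite mul0r addr0 expr0.
  rewrite exprS; have := ler_wpM2l (_ : 0 <= r) IH.
  move=> /(_ (ltW (lt_trans ltr01 r1))); apply: le_trans.
  rewrite -natr1; have := mulr_ge0 (ler0n R k) (sqr_ge0 (r - 1)); lra.
exists (Num.bound (`|T| / (r - 1))); apply: le_trans (B _).
have := archi_boundP (divr_ge0 (normr_ge0 T) (ltW r0)).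
rewrite ltr_pdivrMr// => /ltW h; apply: le_trans (ler_norm T) _.
by apply: le_trans h _; rewrite lerDr.
Qed.

(** Sufficiently many drops would bring the sequence below its lower bound. *)
Lemma no_recurrent_drop (u : nat -> R) k0 b g : 0 < g ->
  (forall k, (k0 <= k)%N -> u k.+1 <= u k) -> (forall k, b <= u k) ->
  (forall k1, exists2 k, (k1 <= k)%N & u k.+1 <= u k - g) -> False.
Proof.
move=> g0 um ub ud.
have mono k k' : (k0 <= k)%N -> (k <= k')%N -> u k' <= u k.
  move=> k0k; elim: k' => [|k' IH]; first by rewrite leqn0 => /eqP ->.
  rewrite leq_eqVlt => /orP[/eqP -> //|]; rewrite ltnS => kk'.
  exact: le_trans (um _ (leq_trans k0k kk')) (IH kk').
have drop (p : nat) : exists2 k, (k0 <= k)%N & u k <= u k0 - p%:R * g.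
  elim: p => [|p [k k0k uk]]; first by exists k0; rewrite // mul0r subr0.
  have [k' kk' uk'] := ud k.
  exists k'.+1; first by rewrite leqW// (leq_trans k0k).
  apply: le_trans uk' _; rewrite -natr1 mulrDl mul1r opprD addrA lerD2r.
  exact: le_trans (mono _ _ k0k kk') uk.
have [k _ uk] := drop (Num.bound ((u k0 - b) / g)).
have ub0 : 0 <= (u k0 - b) / g by rewrite divr_ge0 ?subr_ge0// ltW.
have := archi_boundP ub0; rewrite ltr_pdivrMr// => h.
have := le_trans (ub k) uk; lra.
Qed.

End PenaltyRates.

Section Algorithm.
Context {R : realType} {n m : nat}.
Variables (f : 'cV[R]_n -> R) (c : 'cV[R]_n -> 'cV[R]_m).
Hypothesis m_gt0 : (0 < m)%N.
Hypothesis f_C2 : twice_continuously_differentiable f.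
Hypothesis c_C2 : forall i, twice_continuously_differentiable (fun x => c x i 0).
Variables (prm : inputs R) (eta10 eta20 delta0 : R).
Hypothesis eta10_gt0 : 0 < eta10.
Hypothesis eta20_gt0 : 0 < eta20.
Hypothesis xi_B_gt0 : 0 < xi_B prm.
Hypothesis delta0_range : 0 < delta0 < 1.
Hypothesis beta_range : 0 < beta prm < 2^-1.
Hypothesis nu_gt1 : 1 < nu prm.
Variables (X : set 'cV[R]_n) (Lambda : set 'cV[R]_m).
Hypothesis X_compact : compact X.
Hypothesis Lambda_compact : compact Lambda.
Variables (xi_G Upsilon_B : R).
Hypothesis xi_G_gt0 : 0 < xi_G.
Hypothesis Upsilon_B_gt0 : 0 < Upsilon_B.

Let K := primal_dual_set X Lambda.
Let K_compact : compact K := compact_primal_dual_set X_compact Lambda_compact.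
Let nu_gt0 : 0 < nu prm := lt_trans ltr01 nu_gt1.

Definition regular_point (z : 'cV[R]_(n + m)) (B : 'M[R]_n) : Prop :=
  let G := jac c (usubmx z) in
  [/\ primal_dual_set X Lambda z /\ B^T = B, row_free G,
      forall u, 0 <= dotv u ((G *m G^T - xi_G%:M) *m u),
      forall u, G *m u = 0 -> xi_B prm * norm2 u ^+ 2 <= dotv u (B *m u) &
      opnorm B <= Upsilon_B].

(** Each factor of the denominator is positive, by the positivity of the least
    singular value, and at most one. *)
Lemma Psi_ge1 z B : regular_point z B -> 1 <= Psi c prm z B.
Proof.
move=> [_ _ Gl _ _]; have s0 := least_singular_value_gt0 m_gt0 xi_G_gt0 Gl.
rewrite /Psi; set s := least_singular_value _ in s0 *.
have d0 : 0 < Num.min (xi_B prm) 1 * Num.min (s ^+ 2) 1.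
  by rewrite mulr_gt0// lt_min ltr01 ?exprn_gt0 ?xi_B_gt0.
rewrite ler_pdivlMr// mul1r.
have d1 : Num.min (xi_B prm) 1 * Num.min (s ^+ 2) 1 <= 1.
  by rewrite mulr_ile1// ?le_min ?ge_min ?lexx ?orbT ?sqr_ge0 ?ler01 ?andbT// ltW.
apply: le_trans d1 _.
have M1 : 1 <= Num.max (opnorm B ^+ 2) 1 by rewrite le_max lexx orbT.
apply: le_trans M1 _; rewrite ler_peMl ?ler1n//.
by rewrite le_max ler01 orbT.
Qed.

Lemma delta_trial_gt0 z B eta1 eta2 : regular_point z B -> 0 < eta1 ->
  0 < eta2 -> 0 < delta_trial f c prm z B eta1 eta2.
Proof.
move=> /Psi_ge1 P1 e1 e2; have P0 := lt_le_trans ltr01 P1.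
have U0 : 0 < Upsilon f c z by rewrite /Upsilon lt_max ltr01 orbT.
have /andP[_ b2] := beta_range.
rewrite /delta_trial divr_gt0//; first by rewrite mulr_gt0// subr_gt0.
apply: mulr_gt0; last exact: exprn_gt0.
by apply: mulr_gt0; [rewrite !addr_gt0|exact: exprn_gt0].
Qed.

(** [t] counts all penalty steps since the start of the algorithm. The trial
    values may lower [delta] further, whence only a bound for it. *)
Definition penalty_state (t : nat) (s : inner_state R) : Prop :=
  [/\ inner_eta1 s = eta10 * nu prm ^+ (2 * t),
      inner_eta2 s = eta20 / nu prm ^+ t,
      0 < inner_delta s & inner_delta s <= (nu prm ^+ (4 * t))^-1].

Lemma penalty_state_gt0 t s : penalty_state t s ->
  0 < inner_eta1 s /\ 0 < inner_eta2 s.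
Proof. by move=> [-> -> _ _]; rewrite mulr_gt0 ?divr_gt0 ?exprn_gt0. Qed.

Lemma penalty_state_step z B t s : regular_point z B -> penalty_state t s ->
  penalty_state t.+1 (penalty_step f c prm z B s).
Proof.
move=> zB st; have [e1 e2] := penalty_state_gt0 st.
have d0 : 0 < nu prm ^+ 4 by rewrite exprn_gt0.
case: st => E1 E2 s0 s1; split => /=.
- by rewrite E1 -mulrA -exprD mulnS addnC.
- by rewrite E2 -mulrA -invfM -exprSr.
- rewrite lt_min; apply/andP; split; first exact: divr_gt0.
  apply: delta_trial_gt0 => //; last exact: divr_gt0.
  by apply: mulr_gt0 => //; exact: exprn_gt0.
- rewrite ge_min; apply/orP; left.
  by rewrite mulnS exprD [leRHS]invfM mulrC ler_pM2l ?invr_gt0.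
Qed.

Lemma penalty_state_start z B t eta1 eta2 delta : regular_point z B ->
  penalty_state t (InnerState 0 eta1 eta2 delta) ->
  penalty_state t (inner_start f c prm z B eta1 eta2 delta).
Proof.
move=> zB st; have [/= e1 e2] := penalty_state_gt0 st.
case: st => /= E1 E2 s0 s1; split => //=.
  by rewrite lt_min s0 delta_trial_gt0.
by rewrite ge_min s1.
Qed.

(** The product [opnorm Gamma * Psi] in the accuracy condition is at least
    [C^-1], since [Psi] is at least one and a matrix whose inverse has norm at
    most [C] has itself norm at least [C^-1]. *)
Lemma accuracy_residual : exists2 C, 0 < C & forall z B, regular_point z B ->
  (forall y, norm2 y <= C * norm2 (newton_mx B (jac c (usubmx z)) *m y)) /\
  (forall thetak S s, 0 < thetak <= 1 -> 0 <= inner_delta s ->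
    accuracy f c prm thetak z B S s ->
    norm2 (newton_mx B (jac c (usubmx z)) *m direction f c z B S (inner_j s)
      + kkt_residual f c z)
    <= C * (inner_delta s * norm2 (kkt_residual f c z))).
Proof.
have [C C0 hC] := @newton_mx_lower R n m _ _ _ xi_G_gt0 xi_B_gt0 Upsilon_B_gt0.
exists C => // z B zB; have P1 := Psi_ge1 zB; case: zB => _ Gf Gl Bk BU.
have lowC := hC B _ Gf Gl Bk BU; split=> // thetak S s /andP[th0 th1] s0 acc.
set Gamma := newton_mx B _ in lowC *; set g := kkt_residual f c z.
have op0 : C^-1 <= opnorm Gamma.
  pose u : 'cV[R]_(n + m) := delta_mx (rshift n (Ordinal m_gt0)) 0.
  have u1 : norm2 u = 1 by rewrite /norm2 dotv_delta mxE !eqxx sqrtr1.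
  rewrite -(ler_pM2l C0) mulfV ?gt_eqF// -u1; apply: le_trans (lowC u) _.
  by rewrite ler_pM2l//; apply: opnorm_ge; rewrite u1.
have opP : C^-1 <= opnorm Gamma * Psi c prm z B.
  by apply: le_trans op0 _; rewrite ler_peMr// opnorm_ge0.
have opP0 : 0 < opnorm Gamma * Psi c prm z B.
  by apply: lt_le_trans opP; rewrite invr_gt0.
apply: le_trans acc _; rewrite -/Gamma -/g.
have dg : 0 <= inner_delta s * norm2 g by apply: mulr_ge0 => //; exact: norm2_ge0.
have CP : 1 <= C * (opnorm Gamma * Psi c prm z B).
  by rewrite -(mulfV (lt0r_neq0 C0)) ler_pM2l.
rewrite ler_pdivrMr// -mulrA; apply: (@le_trans _ _ (inner_delta s * norm2 g)).
  exact: ler_piMl.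
rewrite [leRHS]mulrAC; exact: ler_peMl.
Qed.

(** After many penalty steps the geometric rates [eta1 ~ nu^2t],
    [eta2 ~ nu^-t] and [delta <= nu^-4t] make every condition of
    [exact_descent] hold, and make the effect of the inexactness, of order
    [(1 + eta1 + eta2) * delta], negligible against [eta2]. *)
Lemma descent_threshold : exists T, forall z B t thetak S s,
  regular_point z B -> 0 < thetak <= 1 -> T <= nu prm ^+ t ->
  penalty_state t s -> accuracy f c prm thetak z B S s ->
  descent_direction f c z B S s.
Proof.
have [C C0 hC] := accuracy_residual.
have [MG MG0 hMG] := compact_bounded_frobenius K_compact (continuous_jac c_C2).
have [MH MH0 hMH] := compact_bounded_frobenius K_compact (continuous_hess_x f_C2 c_C2).
have [D D0 hD] := @exact_descent R n m _ _ _ _ xi_G_gt0 xi_B_gt0 Upsilon_B_gt0 MH0.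
pose L := (2 + MG + MH) * C ^+ 2 * (1 + eta10 + eta20).
pose T := Num.max (D * eta20) (Num.max (D / (eta10 * eta20)) (4 * L / eta20)).
exists T => z B t thetak S s zB th Tt st acc.
have [lowC resC] := hC _ _ zB.
have [e1 e2] := penalty_state_gt0 st.
case: (zB) => -[Kz Bs] Gf Gl Bk BU; case: st => E1 E2 s0 s1.
set G := jac c (usubmx z) in Gf Gl Bk.
have Gu := unitmx_lower lowC.
set Gamma := newton_mx B G in lowC Gu.
set g := kkt_residual f c z.
have g0 : 0 <= norm2 g by exact: norm2_ge0.
pose dz := - (invmx Gamma *m g); pose y := direction f c z B S (inner_j s) - dz.
have Gdz : Gamma *m dz = - g by rewrite mulmxN mulmxA mulmxV// mul1mx.
have Gy : Gamma *m y = Gamma *m direction f c z B S (inner_j s) + g.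
  by rewrite mulmxBr Gdz opprK.
pose N := nu prm ^+ t; have N0 : 0 < N by rewrite exprn_gt0.
have N1 : 1 <= N by rewrite exprn_ege1// ltW.
have yg : norm2 y <= C ^+ 2 * (inner_delta s * norm2 g).
  apply: le_trans (lowC y) _; rewrite Gy expr2 -mulrA.
  apply: ler_wpM2l; first exact: ltW.
  by apply: (resC thetak) => //; exact: ltW.
rewrite /descent_direction -/g (aug_slopeE f_C2 c_C2).
have -> : direction f c z B S (inner_j s) = dz + y by rewrite addrC subrK.
rewrite (aug_slopeD f_C2 c_C2).
have gE : norm2 g ^+ 2 = norm2 (grad_x_lagrangian f c (usubmx z) (dsubmx z)) ^+ 2
    + norm2 (c (usubmx z)) ^+ 2 by rewrite norm2_col_mx.
set a := grad_x_lagrangian f c (usubmx z) (dsubmx z) in gE.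
have [ag cg] : norm2 a <= norm2 g /\ norm2 (c (usubmx z)) <= norm2 g.
  by split; [exact: norm2_col_mxl|exact: norm2_col_mxr].
have T1 : D * inner_eta2 s <= 1.
  rewrite E2 mulrA ler_pdivrMr// mul1r; apply: le_trans Tt.
  by rewrite /T le_max lexx.
have T2 : D <= inner_eta1 s * inner_eta2 s.
  rewrite E1 E2 mulrACA mul2n -addnn exprD mulfK ?gt_eqF//.
  rewrite mulrC -ler_pdivrMr ?mulr_gt0//; apply: le_trans Tt.
  by rewrite /T !le_max lexx orbT.
have exact_part : aug_slope f c (inner_eta1 s) (inner_eta2 s) z dz <=
    - (3 / 4 * inner_eta2 s * norm2 g ^+ 2).
  rewrite gE; have := hMH _ Kz => HW.
  have := Gdz; rewrite -[dz in X in X -> _]vsubmxK mul_newton_mx /g /kkt_residual.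
  rewrite opp_col_mx => /eq_col_mx[xa xc].
  exact: (hD B _ G _ _ Gf Gl Bk BU Bs HW e2 T1 T2 _ _ _ _ xa xc).
have inexact_part : aug_slope f c (inner_eta1 s) (inner_eta2 s) z y <=
    (2 + MG + MH) * (1 + inner_eta1 s + inner_eta2 s) * norm2 g * norm2 y.
  rewrite /aug_slope -/a -/G.
  have [yx yl] : norm2 (usubmx y) <= norm2 y /\ norm2 (dsubmx y) <= norm2 y.
    rewrite -{2 4}[y]vsubmxK.
    by split; [exact: norm2_col_mxl|exact: norm2_col_mxr].
  have mul_le (F : R) p q (A : 'M[R]_(p, q)) u : frobenius A <= F ->
      norm2 u <= norm2 y -> norm2 (A *m u) <= F * norm2 y.
    move=> AF uy; apply: le_trans (norm2_mulmx_frobenius _ _) _.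
    by apply: ler_pM => //; [exact: frobenius_ge0|exact: norm2_ge0].
  have dot_le p (u v : 'cV[R]_p) r1 r2 : norm2 u <= r1 -> norm2 v <= r2 ->
      dotv u v <= r1 * r2.
    move=> ur vr; apply: le_trans (dotv_le _ _) _.
    by apply: ler_pM => //; exact: norm2_ge0.
  have MGt : frobenius G^T <= MG by rewrite frobenius_tr; exact: hMG.
  have h1 := dot_le _ _ _ _ _ ag yx.
  have h2 := dot_le _ _ _ _ _ cg yl.
  have h3 := dot_le _ _ _ _ _ cg (mul_le _ _ _ _ _ (hMG _ Kz) yx).
  have h4 := dot_le _ _ _ _ _ ag (le_trans (norm2D _ _)
    (lerD (mul_le _ _ _ _ _ (hMH _ Kz) yx) (mul_le _ _ _ _ _ MGt yl))).
  have h3' := ler_wpM2l (ltW e1) h3; have h4' := ler_wpM2l (ltW e2) h4.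
  apply: le_trans (lerD (lerD (lerD h1 h2) h3') h4') _.
  by apply: slope_terms_le => //; [exact: norm2_ge0|exact: ltW|exact: ltW].
apply: le_trans (lerD exact_part inexact_part) _.
have M0 : 0 <= 2 + MG + MH by rewrite !addr_ge0.
apply: (@descent_margin _ _ _ _ (C ^+ 2 * inner_delta s)) => //.
- by rewrite mulr_ge0// !addr_ge0// ltW.
- by rewrite -mulrA.
have AC0 : 0 <= (2 + MG + MH) * C ^+ 2 by rewrite mulr_ge0// sqr_ge0.
rewrite mulrCA mulrA mulrA [_ ^+ 2 * _]mulrC E1 E2 mulnC exprM.
apply: inexact_error_small => //; first by rewrite -exprM mulnC.
rewrite [leRHS]mulrC -ler_pdivrMr//; apply: le_trans Tt.
by rewrite /T !le_max lexx !orbT.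
Qed.

Section InnerLoop.
Variables (z : 'cV[R]_(n + m)) (B : 'M[R]_n) (S : nat -> sketch R (n + m)).
Variable thetak : R.
Hypothesis zB : regular_point z B.
Hypothesis theta_range : 0 < thetak <= 1.

Let Gamma := newton_mx B (jac c (usubmx z)).
Let g := kkt_residual f c z.

Hypothesis residual_small : forall e, 0 < e -> exists J, forall j, (J <= j)%N ->
  norm2 (Gamma *m direction f c z B S j + g) <= e.

Lemma inner_loop_end s s' : inner_loop f c prm thetak z B S s s' ->
  accuracy f c prm thetak z B S s' /\ descent_direction f c z B S s'.
Proof. by elim. Qed.

Lemma direction_kkt0 j : g = 0 -> direction f c z B S j = 0.
Proof.
move=> g0; rewrite /direction -/g g0; elim: j => //= j ->.
by rewrite /sketch_update mulmx0 addr0 mulmx0 subr0.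
Qed.

Let sketched (s : inner_state R) (i : nat) := InnerState (inner_j s + i) (inner_eta1 s) (inner_eta2 s)
  (inner_delta s).

Let sketched0 s : sketched s 0 = s.
Proof. by case: s => *; rewrite /sketched /= addn0. Qed.

(** When the KKT residual vanishes the target is zero, but then so is the
    direction; otherwise the target is positive. *)
Lemma accuracy_reached s : 0 < inner_delta s ->
  exists i, accuracy f c prm thetak z B S (sketched s i).
Proof.
move=> s0; have [g0|g0] := eqVneq g 0.
  exists 0%N; rewrite /accuracy -/g direction_kkt0// g0 mulmx0 addr0 norm20.
  by rewrite mulr0 mul0r.
have gn : 0 < norm2 g by rewrite norm2_gt0.
have /andP[th0 _] := theta_range.
have op0 : 0 < opnorm Gamma.
  have [C C0 hC] := @newton_mx_lower R n m _ _ _ xi_G_gt0 xi_B_gt0 Upsilon_B_gt0.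
  case: zB => _ Gf Gl Bk BU; have := hC B _ Gf Gl Bk BU g.
  rewrite lt_neqAle opnorm_ge0 andbT => h; apply/eqP => op0.
  have := le_trans h (ler_wpM2l (ltW C0) (norm2_mulmx _ g)).
  by rewrite -op0 mul0r mulr0 leNgt gn.
have e0 : 0 < thetak * inner_delta s * norm2 g / (opnorm Gamma * Psi c prm z B).
  apply: divr_gt0; first by rewrite !mulr_gt0.
  by apply: mulr_gt0 => //; exact: lt_le_trans ltr01 (Psi_ge1 zB).
have [J hJ] := residual_small e0.
by exists J; apply: hJ; exact: leq_addl.
Qed.

Lemma reach_accuracy s : 0 < inner_delta s ->
  exists i, accuracy f c prm thetak z B S (sketched s i) /\
  forall s', inner_loop f c prm thetak z B S (sketched s i) s' ->
    inner_loop f c prm thetak z B S s s'.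
Proof.
move=> s0; have [i] := accuracy_reached s0.
elim: i s s0 => [|i IH] s s0 acc.
  by exists 0%N; split => //; rewrite sketched0.
have [sacc|nacc] := pselect (accuracy f c prm thetak z B S s).
  by exists 0%N; rewrite sketched0.
have [|i' [acc' h]] := IH (sketching_step s) s0.
  by move: acc; rewrite /sketched /= addSnnS.
exists i'.+1; have E : sketched s i'.+1 = sketched (sketching_step s) i'.
  by rewrite /sketched /= addSnnS.
rewrite E; split => // s' ss'; apply: inner_sketch => //; exact: h.
Qed.

(** Each penalty step raises the exponent [t], so that the loop performs at
    most [t0] of them; between two of them the sketching updates reach the
    accuracy condition. *)
Lemma inner_loop_terminates T t0 t s : (forall t s, T <= nu prm ^+ t ->
    penalty_state t s -> accuracy f c prm thetak z B S s ->
    descent_direction f c z B S s) ->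
  T <= nu prm ^+ t0 -> penalty_state t s ->
  exists s' t', [/\ inner_loop f c prm thetak z B S s s', penalty_state t' s',
    (t <= t')%N & (t' <= maxn t t0)%N].
Proof.
move=> threshold Tt0.
have : (t0 <= t + (t0 - t))%N by rewrite -leq_subLR.
move: (t0 - t)%N => u; elim: u t s => [|u IH] t s tu st.
all: have [i [acc h]] := reach_accuracy (let: And4 _ _ d _ := st in d).
all: have st' : penalty_state t (sketched s i) by case: st.
all: have [des|ndes] := pselect (descent_direction f c z B S (sketched s i)).
- exists (sketched s i), t; split=> //; last exact: leq_maxl.
  by apply: h; exact: inner_stop.
- case: ndes; apply: (threshold t) => //; apply: le_trans Tt0 _.
  by rewrite ler_weXn2l// ?ltW//; move: tu; rewrite addn0.
- exists (sketched s i), t; split=> //; last exact: leq_maxl.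
  by apply: h; exact: inner_stop.
have [tt0|tt0] := leqP t0 t.
  case: ndes; apply: (threshold t) => //; apply: le_trans Tt0 _.
  by rewrite ler_weXn2l// ltW.
have [|s' [t' [ss' st'' tt' t't]]] :=
    IH t.+1 _ _ (penalty_state_step zB st'); first by rewrite addSnnS.
exists s', t'; split => //.
- by apply: h; exact: inner_penalty.
- exact: ltnW.
- by move: t't; rewrite (maxn_idPr tt0).
Qed.

End InnerLoop.

Section Realization.
Variables (z0 : 'cV[R]_(n + m)) (S : nat -> nat -> sketch R (n + m)).
Variables (z : nat -> 'cV[R]_(n + m)) (B : nat -> 'M[R]_n).
Variables (eta1 eta2 delta : nat -> R).
Hypothesis run : adasketch_newton f c prm z0 eta10 eta20 delta0 S z B eta1 eta2 delta.
Hypothesis theta_range : forall k, 0 < theta prm k <= 1.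
Hypothesis alpha_max_gt0 : 0 < alpha_max prm.
Hypothesis rho_range : 0 < rho prm < 1.
Hypothesis zB : forall k, regular_point (z k) (B k).
Hypothesis residual_small : forall k e, 0 < e -> exists J, forall j, (J <= j)%N ->
  norm2 (newton_mx (B k) (jac c (usubmx (z k))) *m direction f c (z k) (B k) (S k) j
    + kkt_residual f c (z k)) <= e.

Let dir k (s : inner_state R) := direction f c (z k) (B k) (S k) (inner_j s).

(** The exponent [t] never decreases along the run and never exceeds [t0]; from
    the iteration where it takes its largest value it is constant. *)
Lemma penalty_stabilizes : exists e1 e2 k0, [/\ 0 < e1, 0 < e2 &
  forall k, (k0 <= k)%N -> exists s alpha,
  [/\ [/\ inner_eta1 s = e1, inner_eta2 s = e2 & 0 <= inner_delta s <= 1],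
      accuracy f c prm (theta prm k) (z k) (B k) (S k) s,
      descent_direction f c (z k) (B k) (S k) s,
      line_search f c prm (z k) (B k) (S k) s alpha &
      z k.+1 = z k + alpha *: dir k s]].
Proof.
have [T hT] := descent_threshold.
have [t0 Tt0] := expr_unbounded T nu_gt1.
pose st t k := penalty_state t (InnerState 0 (eta1 k) (eta2 k) (delta k)).
have step t k : st t k -> exists t' s alpha, [/\ (t <= t')%N /\ (t' <= maxn t t0)%N,
    penalty_state t' s /\ st t' k.+1,
    accuracy f c prm (theta prm k) (z k) (B k) (S k) s /\
    descent_direction f c (z k) (B k) (S k) s,
    line_search f c prm (z k) (B k) (S k) s alpha &
    z k.+1 = z k + alpha *: dir k s].
  move=> stk.
  have [s [t' [ss' ps tt' t't]]] := inner_loop_terminates (zB k) (theta_range k)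
    (residual_small k)
    (fun t s h => hT _ _ t _ _ s (zB k) (theta_range k) h) Tt0
    (penalty_state_start (zB k) stk).
  have [[alpha ls zE] E1 E2 E3] := adasketch_step run ss'.
  exists t', s, alpha; split => //; last exact: inner_loop_end ss'.
  split => //; case: ps => p1 p2 p3 p4.
  by split => /=; rewrite ?E1 ?E2 ?E3.
have st0 : st 0%N 0%N.
  have [_ E1 E2 E3] := adasketch_init run; have /andP[d0 d1] := delta0_range.
  by split => /=; rewrite ?E1 ?E2 ?E3 ?muln0 ?expr0 ?mulr1 ?divr1 ?invr1// ltW.
have bounded k : exists2 t, (t <= t0)%N & st t k.
  elim: k => [|k [t tt0 stk]]; first by exists 0%N.
  have [t' [s [alpha [[_ t't] [_ st'] _ _ _]]]] := step _ _ stk.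
  by exists t' => //; move: t't; rewrite (maxn_idPr tt0).
pose Q := [pred t | `[< (t <= t0)%N /\ exists k, st t k >]].
have Q0 : exists t, Q t by exists 0%N; apply/asboolP; split => //; exists 0%N.
have Qt0 t : Q t -> (t <= t0)%N by move=> /asboolP[].
case: (ex_maxnP Q0 Qt0) => tm /asboolP[tmt0 [k0 stk0]] tmax.
have stable k : (k0 <= k)%N -> st tm k.
  elim: k => [|k IH]; first by rewrite leqn0 => /eqP <-.
  rewrite leq_eqVlt => /orP[/eqP <- //|]; rewrite ltnS => /IH stk.
  have [t' [s [alpha [[tt' t't] [_ st'] _ _ _]]]] := step _ _ stk.
  have t'm : (t' <= tm)%N.
    apply: tmax; apply/asboolP; split; last by exists k.+1.
    by move: t't; rewrite (maxn_idPr tmt0).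
  by have -> : tm = t' by apply/eqP; rewrite eqn_leq tt' t'm.
exists (eta10 * nu prm ^+ (2 * tm)), (eta20 / nu prm ^+ tm), k0; split.
- by rewrite mulr_gt0// exprn_gt0.
- by rewrite divr_gt0// exprn_gt0.
move=> k k0k; have stk := stable _ k0k.
have [t' [s [alpha [[tt' t't] [ps st'] [acc des] ls zE]]]] := step _ _ stk.
have t'm : t' = tm.
  apply/eqP; rewrite eqn_leq tt' andbT; apply: tmax; apply/asboolP.
  by split; [move: t't; rewrite (maxn_idPr tmt0)|exists k.+1].
exists s, alpha; split => //; case: ps => -> -> d0 d1; rewrite t'm.
split=> //; rewrite (ltW d0) (le_trans d1)// invf_le1 ?exprn_gt0//.
by rewrite exprn_ege1// ltW.
Qed.

Lemma accurate_direction_bounded : exists2 M, 0 <= M & forall k s,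
  0 <= inner_delta s <= 1 ->
  accuracy f c prm (theta prm k) (z k) (B k) (S k) s -> norm2 (dir k s) <= M.
Proof.
have [C C0 hC] := accuracy_residual.
have [W W0 hW] : exists2 W, 0 <= W &
    forall z, K z -> frobenius (kkt_residual f c z) <= W.
  apply: compact_bounded_frobenius => // i j; rewrite (ord1 j).
  exact: continuous_kkt_residual.
exists (C * (C * W + W)).
  by rewrite mulr_ge0 ?addr_ge0 ?mulr_ge0// ltW.
move=> k s /andP[s0 s1] acc; have [lowC resC] := hC _ _ (zB k).
have gW : norm2 (kkt_residual f c (z k)) <= W.
  by rewrite norm2_frobenius; apply: hW; case: (zB k) => -[].
apply: le_trans (lowC _) _; apply: ler_wpM2l; first exact: ltW.
rewrite -[X in norm2 X](addrK (kkt_residual f c (z k))).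
apply: le_trans (norm2B _ _) _; apply: lerD => //.
apply: le_trans (resC _ _ _ (theta_range k) s0 acc) _.
apply: ler_wpM2l; first exact: ltW.
by rewrite -[leRHS]mul1r; apply: ler_pM => //; exact: norm2_ge0.
Qed.

(** Once the penalty parameters are constant, the augmented Lagrangian is a fixed
    function that decreases along the iterates, by at least a fixed amount
    whenever the KKT residual is at least [e]. *)
Lemma realization_converges : (fun k => norm2 (kkt_residual f c (z k))) @ \oo --> (0 : R).
Proof.
have [e1 [e2 [k0 [e10 e20 H]]]] := penalty_stabilizes.
have [M M0 hM] := accurate_direction_bounded.
have /andP[b0 b2] := beta_range; have /andP[r0 r1] := rho_range.
have b1 : beta prm < 1 by apply: lt_trans b2 _; rewrite invf_lt1// ltr1n.
have Kz k : K (z k) by case: (zB k) => -[].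
pose u k := aug_lagrangian f c e1 e2 (z k).
have [W W0 hW] : exists2 W, 0 < W &
    forall z, K z -> `|aug_lagrangian f c e1 e2 z| <= W.
  by apply: compact_bounded_fun => //; exact: continuous_aug_lagrangian.
apply/cvgrPdist_lt => e ee; apply: contrapT => nnear.
have often k1 : exists2 k, (k1 <= k)%N & e <= norm2 (kkt_residual f c (z k)).
  apply: contrapT => no; apply: nnear; exists k1 => // k /= k1k.
  rewrite sub0r normrN ger0_norm ?norm2_ge0// ltNge; apply/negP => ek.
  by apply: no; exists k.
pose E := e2 * e ^+ 2 / 2; have E0 : 0 < E by rewrite divr_gt0// mulr_gt0// exprn_gt0.
have [a a0 ha] := armijo_short_steps f_C2 c_C2 e1 e2 K_compact M0 E0 b1.
pose amin := Num.min (alpha_max prm) (rho prm * a).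
have amin0 : 0 < amin by rewrite lt_min alpha_max_gt0 mulr_gt0.
have slope k s : inner_eta1 s = e1 -> inner_eta2 s = e2 ->
    descent_direction f c (z k) (B k) (S k) s ->
    aug_slope f c e1 e2 (z k) (dir k s) <=
      - (e2 * norm2 (kkt_residual f c (z k)) ^+ 2 / 2).
  by move=> E1 E2; rewrite /descent_direction E1 E2 (aug_slopeE f_C2 c_C2).
have armijoE k s alpha : inner_eta1 s = e1 -> inner_eta2 s = e2 ->
    armijo f c prm (z k) (B k) (S k) s alpha <->
    aug_lagrangian f c e1 e2 (z k + alpha *: dir k s) <=
      u k + alpha * beta prm * aug_slope f c e1 e2 (z k) (dir k s).
  by move=> E1 E2; rewrite /armijo E1 E2 (aug_slopeE f_C2 c_C2).
have alpha_gt0 k s alpha : line_search f c prm (z k) (B k) (S k) s alpha -> 0 < alpha.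
  by move=> [t [-> _ _]]; rewrite mulr_gt0// exprn_gt0.
apply: (@no_recurrent_drop _ u k0 (- W) (amin * beta prm * E)).
- by rewrite !mulr_gt0.
- move=> k /H[s [alpha [[E1 E2 _] _ des ls zE]]].
  have al0 := alpha_gt0 _ _ _ ls; case: ls => t [_ /(armijoE _ _ _ E1 E2) ar _].
  rewrite /u zE; apply: le_trans ar _; rewrite gerDl mulr_ge0_le0//.
    by rewrite mulr_ge0// ltW.
  apply: le_trans (slope _ _ E1 E2 des) _.
  by rewrite oppr_le0 divr_ge0// mulr_ge0 ?sqr_ge0// ltW.
- by move=> k; have := hW _ (Kz k); rewrite ler_norml => /andP[].
move=> k1; have [k kk1 ek] := often (maxn k0 k1).
have [k0k k1k] : (k0 <= k)%N /\ (k1 <= k)%N by move: kk1; rewrite geq_max => /andP.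
exists k => //; have [s [alpha [[E1 E2 d01] acc des ls zE]]] := H _ k0k.
have slE : aug_slope f c e1 e2 (z k) (dir k s) <= - E.
  apply: le_trans (slope _ _ E1 E2 des) _; rewrite lerN2 /E.
  by rewrite ler_pM2r ?invr_gt0// ler_pM2l// ler_pXn2r// nnegrE ?norm2_ge0// ltW.
have al0 := alpha_gt0 _ _ _ ls.
(* The trial step before the accepted one was rejected, hence not short. *)
have alpha_ge : amin <= alpha.
  case: ls => -[|t] [-> _ rej]; first by rewrite expr0 mulr1 ge_min lexx.
  rewrite ge_min; apply/orP; right; rewrite exprS mulrCA; apply: ler_wpM2l.
    exact: ltW.
  rewrite leNgt; apply/negP => short; apply: (rej t (ltnSn t)).
  apply/(armijoE _ _ _ E1 E2); apply: ha => //; first exact: hM.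
  by rewrite mulr_gt0 ?exprn_gt0//= ltW.
case: ls => t [_ /(armijoE _ _ _ E1 E2) ar _].
rewrite {1}/u zE; apply: le_trans ar _; rewrite lerD2l.
have ab0 : 0 <= alpha * beta prm by rewrite mulr_ge0// ltW.
apply: le_trans (ler_wpM2l ab0 slE) _; rewrite mulrN lerN2.
by rewrite ler_pM2r// ler_pM2r.
Qed.

End Realization.

End Algorithm.

(** * Sketching steps as random projections *)

Section SketchProjection.
Context {R : realType} {p : nat}.
Implicit Types (Gamma : 'M[R]_p) (S : sketch R p) (y : 'cV[R]_p).

Definition sketch_proj Gamma S : 'M[R]_p := range_proj (Gamma *m tagged S).

Lemma sketch_proj_tr Gamma S : (sketch_proj Gamma S)^T = sketch_proj Gamma S.
Proof. exact: range_proj_tr. Qed.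

Lemma sketch_proj_idem Gamma S :
  sketch_proj Gamma S *m sketch_proj Gamma S = sketch_proj Gamma S.
Proof. exact: range_proj_idem. Qed.

(** In terms of the error [dz - dzs] with respect to the exact direction [dzs],
    a sketching update subtracts the orthogonal projection of the error onto
    the range of [Gamma *m S]. *)
Lemma sketch_update_error Gamma g S dz dzs : Gamma^T = Gamma ->
  Gamma *m dzs = - g ->
  sketch_update Gamma g S dz - dzs =
    (dz - dzs) - sketch_proj Gamma S *m (dz - dzs).
Proof.
move=> Gs dzsE; rewrite /sketch_update /sketch_proj /range_proj.
rewrite addrAC; congr (_ - _); rewrite -[g]opprK -dzsE -mulmxBr.
by rewrite trmx_mul Gs !mulmxA.
Qed.

Definition captured Gamma S y : R := dotv y (sketch_proj Gamma S *m y).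

Lemma capturedE Gamma S y :
  captured Gamma S y = norm2 (sketch_proj Gamma S *m y) ^+ 2.
Proof.
rewrite /captured norm2_sqr -{1}sketch_proj_idem -mulmxA dotv_mulmx.
by rewrite sketch_proj_tr.
Qed.

Lemma captured_ge0 Gamma S y : 0 <= captured Gamma S y.
Proof. by rewrite capturedE sqr_ge0. Qed.

Lemma captured_pythagoras Gamma S y :
  norm2 (y - sketch_proj Gamma S *m y) ^+ 2 = norm2 y ^+ 2 - captured Gamma S y.
Proof.
have := capturedE Gamma S y; rewrite /captured !norm2_sqr => cE.
rewrite !(dotvDl, dotvDr, dotvNl, dotvNr) -cE [dotv (_ *m _) y]dotvC; ring.
Qed.

Lemma captured_le Gamma S y : captured Gamma S y <= norm2 y ^+ 2.
Proof. by rewrite -subr_ge0 -captured_pythagoras sqr_ge0. Qed.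

(** A sketch captures nothing of [y] only if [y] is orthogonal to the range of
    [Gamma *m S]; this turns the hypothesis on the sketches into one on the
    captured energy. *)
Lemma captured_eq0 Gamma S y :
  (captured Gamma S y == 0) = ((tagged S)^T *m (Gamma^T *m y) == 0).
Proof.
rewrite capturedE sqrf_eq0 norm2_eq0 mulmxA -trmx_mul; apply/eqP/eqP => h.
  by rewrite -(tr_mul_range_proj (Gamma *m _)) -mulmxA [range_proj _ *m y]h mulmx0.
by rewrite /sketch_proj /range_proj -mulmxA h mulmx0.
Qed.

Lemma norm2_sketch_proj Gamma S y : norm2 (sketch_proj Gamma S *m y) <= norm2 y.
Proof.
rewrite -(ler_pXn2r (_ : 0 < 2)%N) ?nnegrE ?norm2_ge0//.
by rewrite -capturedE captured_le.
Qed.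

Lemma captured_lipschitz Gamma S y y' : norm2 y <= 1 -> norm2 y' <= 1 ->
  captured Gamma S y <= captured Gamma S y' + 2 * norm2 (y - y').
Proof.
move=> y1 y'1; set d := y - y'; have yE : y = y' + d by rewrite addrC subrK.
set P := sketch_proj Gamma S.
have E1 : dotv y (P *m y) = dotv y' (P *m y) + dotv d (P *m y).
  by rewrite -dotvDl -yE.
have E2 : dotv y' (P *m y) = dotv y (P *m y').
  by rewrite dotv_mulmx sketch_proj_tr dotvC.
have E3 : dotv y (P *m y') = dotv y' (P *m y') + dotv d (P *m y').
  by rewrite -dotvDl -yE.
rewrite /captured -/P E1 E2 E3 -addrA lerD2l.
have le v : norm2 v <= 1 -> dotv d (sketch_proj Gamma S *m v) <= norm2 d.
  move=> v1; apply: le_trans (dotv_le _ _) _.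
  rewrite ler_piMr ?norm2_ge0//; apply: le_trans (norm2_sketch_proj _ _ _) v1.
by apply: le_trans (lerD (le _ y'1) (le _ y1)) _; rewrite mulr_natl mulr2n.
Qed.

Lemma captured_scale Gamma S a y :
  captured Gamma S (a *: y) = a ^+ 2 * captured Gamma S y.
Proof. by rewrite /captured -scalemxAr dotvZl dotvZr mulrA. Qed.

(** Polarization: the coordinates of the projection are combinations of
    captured energies. *)
Lemma sketch_proj_coord Gamma S y i : (sketch_proj Gamma S *m y) i 0 =
  4^-1 * (captured Gamma S (y + delta_mx i 0) - captured Gamma S (y - delta_mx i 0)).
Proof.
rewrite /captured !mulmxBr !mulmxDr !(dotvDl, dotvDr, dotvNl, dotvNr).
rewrite ![dotv (delta_mx i 0) (_ *m y)]dotvC !dotv_delta.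
have -> : dotv y (sketch_proj Gamma S *m delta_mx i 0) = (sketch_proj Gamma S *m y) i 0.
  by rewrite dotv_mulmx sketch_proj_tr dotv_delta.
by field.
Qed.

(** A vector of rational coefficients determines a combination of the columns
    of every sketch, whatever its number of columns. *)
Definition rat_comb (w : seq rat) S : 'cV[R]_p :=
  tagged S *m \col_(j < tag S) (ratr (nth 0 w j) : R).

(** Sequences of rationals are enumerated by their codes; a number that codes no
    sequence stands for the empty one. *)
Definition rat_dist Gamma S y (k : nat) : R :=
  norm2 (y - Gamma *m rat_comb (odflt [::] (unpickle k)) S) ^+ 2.

Lemma norm2_sub_range Gamma S y v :
  norm2 (y - Gamma *m (tagged S *m v)) ^+ 2 = norm2 (y - sketch_proj Gamma S *m y) ^+ 2
   + norm2 (sketch_proj Gamma S *m y - Gamma *m (tagged S *m v)) ^+ 2.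
Proof.
set P := sketch_proj Gamma S; set u := y - P *m y; set w := P *m y - _.
have -> : y - Gamma *m (tagged S *m v) = u + w by rewrite addrA subrK.
have uw : dotv u w = 0.
  have Pr : P *m (Gamma *m (tagged S *m v)) = Gamma *m (tagged S *m v).
    by rewrite !mulmxA -(mulmxA P) range_proj_mul.
  have PP : P *m (P *m y) = P *m y by rewrite mulmxA [P *m P]sketch_proj_idem.
  have -> : w = P *m w by rewrite /w mulmxBr Pr PP.
  by rewrite dotv_mulmx sketch_proj_tr /u mulmxBr PP subrr dotv0l.
clearbody u w.
by rewrite !norm2_sqr !(dotvDl, dotvDr) (dotvC w u) uw addr0 add0r.
Qed.

Lemma rat_approx q (v : 'cV[R]_q) e : 0 < e ->
  exists w : seq rat, norm2 (v - \col_(j < q) (ratr (nth 0 w j) : R)) <= e.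
Proof.
move=> e0; pose r := e / (1 + q%:R).
have r0 : 0 < r by rewrite divr_gt0// ltr_pwDl.
have eE : e = r * (1 + q%:R) by rewrite divfK// gt_eqF// ltr_pwDl.
clearbody r.
have H j : exists t : rat, `|v j 0 - ratr t| <= r.
  have lt : v j 0 - r < v j 0 + r by rewrite ltrD2l gtrN.
  have [t] := rat_in_itvoo lt; rewrite in_itv /= => /andP[t1 t2].
  exists t; rewrite ler_distlC; apply/andP; split; exact: ltW.
have [t ht] := choice H.
exists [seq t j | j <- enum 'I_q].
rewrite -(ler_pXn2r (_ : 0 < 2)%N) ?nnegrE ?norm2_ge0 ?(ltW e0)//.
rewrite norm2_sqr dotvE.
rewrite eE; apply: (@le_trans _ _ (\sum_(j < q) r ^+ 2)).
  apply: ler_sum => j _; rewrite !mxE (nth_map j) ?size_enum_ord//.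
  rewrite nth_ord_enum -expr2 -[leLHS]real_normK ?num_real//.
  by rewrite ler_pXn2r// nnegrE// ltW.
rewrite sumr_const card_ord -[leLHS]mulr_natr exprMn ler_wpM2l ?sqr_ge0//.
have := ler0n R q; nra.
Qed.

(** Rational combinations of the columns are dense in the column space, whose
    nearest point to [y] is the projection. *)
Lemma rat_dist_inf Gamma S y :
  norm2 (y - sketch_proj Gamma S *m y) ^+ 2 = infs (rat_dist Gamma S y) 0.
Proof.
set P := sketch_proj Gamma S; pose l := norm2 (y - P *m y) ^+ 2.
have lb k : l <= rat_dist Gamma S y k.
  by rewrite /rat_dist /rat_comb norm2_sub_range -/P lerDl sqr_ge0.
rewrite -/l; apply/eqP; rewrite eq_le; apply/andP; split.
  apply: lb_le_inf; first by exists (rat_dist Gamma S y 0), 0%N.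
  by move=> _ [k _ <-].
apply/ler_addgt0Pr => e e0.
pose v := mp_pinv ((Gamma *m tagged S)^T *m (Gamma *m tagged S)) *m
  ((Gamma *m tagged S)^T *m y).
have Pv : P *m y = Gamma *m (tagged S *m v).
  by rewrite /P /sketch_proj /range_proj /v !mulmxA.
pose F := frobenius (Gamma *m tagged S); have F0 : 0 <= F := frobenius_ge0 _.
have e1 : 0 < Num.min 1 e / (1 + F).
  by rewrite divr_gt0// ?lt_min ?ltr01// ltr_wpDr.
have [w hw] := rat_approx v e1.
have hk : rat_dist Gamma S y (pickle w) <= l + e.
  rewrite /rat_dist pickleK /= norm2_sub_range -/P -/l lerD2l Pv -mulmxBr -mulmxBr.
  rewrite mulmxA; set d := v - _.
  have Fd : norm2 (Gamma *m tagged S *m d) <= Num.min 1 e.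
    apply: le_trans (norm2_mulmx_frobenius _ _) _.
    apply: le_trans (ler_wpM2l F0 hw) _.
    rewrite mulrCA ler_piMr//; first by rewrite le_min ler01 ltW.
    by rewrite ler_pdivrMr ?mul1r ?lerDr// ltr_wpDr.
  move: Fd; rewrite le_min => /andP[d1 de].
  rewrite expr2; apply: le_trans de; rewrite ler_piMl// norm2_ge0//.
apply: le_trans hk; apply: ge_inf; first by exists l => _ [k _ <-].
by exists (pickle w).
Qed.

End SketchProjection.

Section Measurability.
Context {R : realType}.

Lemma borel_continuous_measurable p q (h : 'M[R]_(p, q) -> R) : continuous h ->
  measurable_fun setT (h : borel_mx R p q -> R).
Proof.
move=> hc; apply: (measurability _ (RGenOpens.measurableE R)).
move=> _ [_ [a [b ->]] <-]; rewrite setTI; apply: sub_sigma_algebra.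
by apply: open_comp => [x _|]; [exact: hc|exact: interval_open].
Qed.

Section Fields.
Context {d : measure_display} {T : measurableType d}.

Definition measurable_mx p q (F : T -> 'M[R]_(p, q)) : Prop :=
  forall i j, measurable_fun setT (fun t => F t i j).

Lemma measurable_mx_cst p q (A : 'M[R]_(p, q)) : measurable_mx (fun=> A).
Proof. by move=> i j; exact: measurable_cst. Qed.

Lemma measurable_mxD p q (F G : T -> 'M[R]_(p, q)) : measurable_mx F ->
  measurable_mx G -> measurable_mx (fun t => F t + G t).
Proof.
move=> mF mG i j; under eq_fun do rewrite mxE.
exact: measurable_funD.
Qed.

Lemma measurable_mxB p q (F G : T -> 'M[R]_(p, q)) : measurable_mx F ->
  measurable_mx G -> measurable_mx (fun t => F t - G t).
Proof.
move=> mF mG i j; under eq_fun do rewrite !mxE.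
exact: measurable_funB.
Qed.

Lemma measurable_mxZ p q (a : T -> R) (F : T -> 'M[R]_(p, q)) :
  measurable_fun setT a -> measurable_mx F -> measurable_mx (fun t => a t *: F t).
Proof.
move=> ma mF i j; under eq_fun do rewrite mxE.
exact: measurable_funM.
Qed.

Lemma measurable_mxM p q r (F : T -> 'M[R]_(p, q)) (G : T -> 'M[R]_(q, r)) :
  measurable_mx F -> measurable_mx G -> measurable_mx (fun t => F t *m G t).
Proof.
move=> mF mG i j; under eq_fun do rewrite mxE.
by apply: measurable_sum => k; exact: measurable_funM.
Qed.

Lemma measurable_det p (F : T -> 'M[R]_p) : measurable_mx F ->
  measurable_fun setT (fun t => \det (F t)).
Proof.
move=> mF; rewrite /determinant; apply: measurable_sum => s.
apply: measurable_funM; first exact: measurable_cst.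
by apply: measurable_prod => i _; exact: mF.
Qed.

Lemma measurable_adj p (F : T -> 'M[R]_p) : measurable_mx F ->
  measurable_mx (fun t => \adj (F t)).
Proof.
move=> mF i j; under eq_fun do rewrite mxE /cofactor.
apply: measurable_funM; first exact: measurable_cst.
by apply: measurable_det => k l; under eq_fun do rewrite !mxE; exact: mF.
Qed.

Lemma measurable_norm2_sqr p (F : T -> 'cV[R]_p) : measurable_mx F ->
  measurable_fun setT (fun t => norm2 (F t) ^+ 2).
Proof.
move=> mF; under eq_fun do rewrite norm2_sqr dotvE.
by apply: measurable_sum => i; exact: measurable_funM.
Qed.

Variables (p : nat) (Gamma : T -> 'M[R]_p) (S : T -> sketch R p).
Hypotheses (mGamma : measurable_mx Gamma) (mS : measurable_fun setT S).

Lemma measurable_rat_comb w : measurable_mx (fun t => rat_comb w (S t)).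
Proof.
move=> i j; pose h (M : sketch R p) : R := rat_comb w M i j.
suff mh : measurable_fun setT h by exact: (measurableT_comp mh mS).
move=> _ U mU; rewrite setTI.
suff : sketch_measurable (h @^-1` U) by [].
move=> q; rewrite -comp_preimage -[X in measurable X]setTI.
have mq : measurable_fun setT ((fun M : 'M[R]_(p, q) =>
    (M *m \col_(l < q) (ratr (nth 0 w l) : R)) i j) : borel_mx R p q -> R).
  apply: borel_continuous_measurable; rewrite (ord1 j).
  apply: (continuous_mulmx_cst _ (F := id)) => k l; exact: coord_continuous.
exact: mq.
Qed.

(** The projections inherit measurability from the distance to the range, a
    countable infimum of polynomials in the entries, by polarization. *)
Lemma measurable_captured (y : T -> 'cV[R]_p) : measurable_mx y ->
  measurable_fun setT (fun t => captured (Gamma t) (S t) (y t)).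
Proof.
move=> my.
have -> : (fun t => captured (Gamma t) (S t) (y t)) =
    (fun t => norm2 (y t) ^+ 2 - infs (rat_dist (Gamma t) (S t) (y t)) 0).
  apply/funext => t; rewrite -rat_dist_inf captured_pythagoras.
  by rewrite opprB addrC subrK.
apply: measurable_funB; first exact: measurable_norm2_sqr.
apply: (@measurable_fun_infs _ _ _ setT (fun k t => rat_dist (Gamma t) (S t) (y t) k)).
  by move=> t _; exists 0 => _ [k _ <-]; exact: sqr_ge0.
move=> k; apply: measurable_norm2_sqr; apply: measurable_mxB => //.
by apply: measurable_mxM => //; exact: measurable_rat_comb.
Qed.

Lemma measurable_sketch_proj (y : T -> 'cV[R]_p) : measurable_mx y ->
  measurable_mx (fun t => sketch_proj (Gamma t) (S t) *m y t).
Proof.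
move=> my i j; rewrite (ord1 j); under eq_fun do rewrite sketch_proj_coord.
apply: measurable_funM; first exact: measurable_cst.
apply: measurable_funB; apply: measurable_captured.
  by apply: measurable_mxD => //; exact: measurable_mx_cst.
by apply: measurable_mxB => //; exact: measurable_mx_cst.
Qed.

End Fields.
End Measurability.

(** * Mean energy captured by one sketch *)

Section MeanCaptured.
Context {R : realType} {p : nat}.
Variables (mu : probability (sketch R p) R) (pi0 : R).
Hypothesis pi0_gt0 : 0 < pi0.
Hypothesis sketch_nonzero : forall u : 'cV[R]_p, u != 0 ->
  (pi0%:E <= mu [set M : sketch R p | ((tagged M)^T *m u != 0)%R])%E.

Definition mean_captured (Gamma : 'M[R]_p) (y : 'cV[R]_p) : \bar R :=
  (\int[mu]_M (captured Gamma M y)%:E)%E.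

Lemma measurable_captured_sketch Gamma y :
  measurable_fun setT (fun M : sketch R p => captured Gamma M y).
Proof.
apply: (@measurable_captured R _ (sketch R p) p (fun=> Gamma) id _ _ (fun=> y)).
- exact: measurable_mx_cst.
- exact: measurable_id.
- exact: measurable_mx_cst.
Qed.

Lemma mean_captured_ge0 Gamma y : (0 <= mean_captured Gamma y)%E.
Proof. by apply: integral_ge0 => M _; rewrite lee_fin captured_ge0. Qed.

Lemma mean_captured_fin Gamma y : mean_captured Gamma y \is a fin_num.
Proof.
rewrite ge0_fin_numE ?mean_captured_ge0//.
apply: (@le_lt_trans _ _ (\int[mu]_M (norm2 y ^+ 2)%:E)%E).
  apply: ge0_le_integral => //.
  - by move=> M _; rewrite lee_fin captured_ge0.
  - by apply/measurable_EFinP; exact: measurable_captured_sketch.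
  - by move=> M _; rewrite lee_fin captured_le.
by rewrite integral_cst//= [X in (_ * X)%E](probability_setT mu) mule1 ltry.
Qed.

(** A zero mean would make the captured energy vanish almost everywhere, against
    the probability [pi0] that the sketch sees [Gamma^T *m y]. *)
Lemma mean_captured_gt0 Gamma y : Gamma \in unitmx -> y != 0 ->
  (0 < mean_captured Gamma y)%E.
Proof.
move=> Gu y0; rewrite lt_neqAle mean_captured_ge0 andbT eq_sym.
apply/eqP => m0.
have mc := measurable_captured_sketch Gamma y.
have : (\int[mu]_M `|(captured Gamma M y)%:E| = 0)%E.
  rewrite -m0; apply: eq_integral => M _.
  by rewrite gee0_abs// lee_fin captured_ge0.
have mE : measurable_fun setT (fun M : sketch R p => (captured Gamma M y)%:E).
  exact/measurable_EFinP.
move=> /(ae_eq_integral_abs mu measurableT mE)[N [mN N0 subN]].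
have u0 : Gamma^T *m y != 0.
  apply: contra y0 => /eqP u0; apply/eqP; rewrite -[y]mul1mx.
  by rewrite -(mulVmx (_ : Gamma^T \in unitmx)) ?unitmx_tr// -mulmxA u0 mulmx0.
have AE : [set M : sketch R p | (tagged M)^T *m (Gamma^T *m y) != 0] =
    (fun M : sketch R p => captured Gamma M y) @^-1` (~` [set 0]).
  apply/seteqP; split => M /=; rewrite -captured_eq0; first by move/eqP.
  by move=> h; apply/eqP.
have mA : measurable [set M : sketch R p | (tagged M)^T *m (Gamma^T *m y) != 0].
  by rewrite AE -[X in measurable X]setTI; apply: mc => //; exact: measurableC.
have := sketch_nonzero u0.
suff -> : mu [set M : sketch R p | (tagged M)^T *m (Gamma^T *m y) != 0] = 0%E.
  by rewrite lee_fin leNgt pi0_gt0.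
apply/eqP; rewrite eq_le measure_ge0 andbT -N0; apply: le_measure; rewrite ?inE//.
apply: subset_trans subN; rewrite AE => M /= M0 h; apply: M0.
by have [] := h Logic.I.
Qed.

Lemma mean_captured_lipschitz Gamma y y' : norm2 y <= 1 -> norm2 y' <= 1 ->
  (mean_captured Gamma y <= mean_captured Gamma y' + (2 * norm2 (y - y'))%:E)%E.
Proof.
move=> y1 y'1.
have d0 : 0 <= 2 * norm2 (y - y') by rewrite mulr_ge0// norm2_ge0.
have mE v : measurable_fun setT (fun M : sketch R p => (captured Gamma M v)%:E).
  by apply/measurable_EFinP; exact: measurable_captured_sketch.
have cE : (\int[mu]_(M in setT) (2 * norm2 (y - y'))%:E = (2 * norm2 (y - y'))%:E)%E.
  by rewrite integral_cst//= [X in (_ * X)%E](probability_setT mu) mule1.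
rewrite -cE -ge0_integralD//.
- apply: ge0_le_integral => //.
  + by move=> M _; rewrite lee_fin captured_ge0.
  + exact: emeasurable_funD.
  + by move=> M _; rewrite -EFinD lee_fin captured_lipschitz.
- by move=> M _; rewrite lee_fin captured_ge0.
Qed.

Lemma mean_captured_scale Gamma a y :
  mean_captured Gamma (a *: y) = ((a ^+ 2)%:E * mean_captured Gamma y)%E.
Proof.
rewrite /mean_captured; under eq_integral do rewrite captured_scale EFinM.
rewrite ge0_integralZl//.
- by apply/measurable_EFinP; exact: measurable_captured_sketch.
- by move=> M _; rewrite lee_fin captured_ge0.
- by rewrite lee_fin sqr_ge0.
Qed.

(** The mean captured energy is positive and continuous on the compact unit
    sphere, hence a fixed fraction of the error energy. *)
Lemma mean_captured_lower Gamma : Gamma \in unitmx -> exists2 kappa, 0 < kappa &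
  forall y, ((kappa * norm2 y ^+ 2)%:E <= mean_captured Gamma y)%E.
Proof.
move=> Gu; pose Q (k : R) (y : 'cV[R]_p) :=
  dotv y y = 1 -> (k%:E <= mean_captured Gamma y)%E.
have norm1 y : dotv y y = 1 -> norm2 y = 1 by rewrite /norm2 => ->; rewrite sqrtr1.
suff : \forall k \near 0^'+, [set y : 'cV[R]_p | dotv y y = 1] `<=` Q k.
  move=> /(filterI (nbhs_right_gt 0)) /filter_ex[k [k0 hk]]; exists k => // y.
  have [->|y0] := eqVneq y 0.
    by rewrite norm20 expr0n mulr0 mean_captured_ge0.
  have ny : 0 < norm2 y by rewrite norm2_gt0.
  have yE : y = norm2 y *: ((norm2 y)^-1 *: y) by rewrite scalerA mulfV ?scale1r// gt_eqF.
  rewrite {2}yE mean_captured_scale mulrC EFinM.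
  apply: lee_pmul => //; [by rewrite lee_fin sqr_ge0|by rewrite lee_fin ltW|].
  have u1 : dotv ((norm2 y)^-1 *: y) ((norm2 y)^-1 *: y) = 1.
    by rewrite dotvZl dotvZr -norm2_sqr; field; rewrite gt_eqF.
  exact: hk.
have /compact_near_coveringP := @compact_unit_sphere R p; apply => y y1.
have y0 : y != 0.
  by apply/eqP => y0; move: y1; rewrite y0 /= dotv0r => /eqP; rewrite eq_sym oner_eq0.
pose c0 := fine (mean_captured Gamma y).
have c0E : mean_captured Gamma y = c0%:E by rewrite fineK ?mean_captured_fin.
have c00 : 0 < c0 by rewrite -lte_fin -c0E mean_captured_gt0.
have c4 : 0 < c0 / 4 by rewrite divr_gt0.
have nc : continuous (fun y' : 'cV[R]_p => dotv (y - y') (y - y')).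
  under eq_fun do rewrite dotvE; apply: continuous_sum => i.
  have ci : continuous (fun y' : 'cV[R]_p => (y - y') i 0).
    under eq_fun do rewrite !mxE.
    move=> y'; apply: (@continuousB _ _ _ (cst (y i 0)) (fun y' : 'cV[R]_p => y' i 0)).
      exact: cst_continuous.
    exact: coord_continuous.
  exact: continuous_mul.
have near_y : \forall y' \near y, dotv (y - y') (y - y') < (c0 / 4) ^+ 2.
  by apply: (cvgr_lt _ (nc y)); rewrite subrr dotv0r exprn_gt0.
exists ([set y' | dotv (y - y') (y - y') < (c0 / 4) ^+ 2], [set k | k < c0 / 2]).
  by split => //; apply: nbhs_right_lt; rewrite divr_gt0.
move=> [y' k] [/= y'y kc] y'1.
have d : norm2 (y - y') < c0 / 4.
  by rewrite -(ltr_pXn2r (_ : 0 < 2)%N) ?nnegrE ?norm2_ge0 ?(ltW c4)// norm2_sqr.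
have [n1 n1'] : norm2 y <= 1 /\ norm2 y' <= 1 by rewrite !norm1.
have := mean_captured_lipschitz Gamma n1 n1'; rewrite c0E.
rewrite -(fineK (mean_captured_fin Gamma y')) -EFinD !lee_fin; lra.
Qed.

End MeanCaptured.

(** * Independence of a sketch from its past *)

Section Freezing.
Context {d d1 d2 : measure_display} {Omega : measurableType d}
  {T1 : measurableType d1} {T2 : measurableType d2} {R : realType}.
Variables (P : probability Omega R) (X : Omega -> T1) (S : Omega -> T2).
Variable mu : probability T2 R.
Hypothesis mX : measurable_fun setT X.
Hypothesis mS : measurable_fun setT S.
Hypothesis XS_indep : forall A B, measurable A -> measurable B ->
  P (X @^-1` A `&` S @^-1` B) = (P (X @^-1` A) * mu B)%E.

(** The joint law of [X] and [S] is the product of their laws, so by Tonelli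
    the second variable may be integrated with the first one frozen. *)
Lemma ge0_integral_freezing (h : T1 * T2 -> \bar R) : measurable_fun setT h ->
  (forall x, 0 <= h x)%E ->
  (\int[P]_w h (X w, S w) = \int[P]_w \int[mu]_M h (X w, M))%E.
Proof.
move=> mh h0.
pose X' : {mfun Omega >-> T1} := HB.pack X (isMeasurableFun.Build _ _ _ _ X mX).
have mZ : measurable_fun setT (fun w => (X w, S w)) by exact: measurable_fun_pair.
pose Z : {mfun Omega >-> (T1 * T2)%type} :=
  HB.pack (fun w => (X w, S w)) (isMeasurableFun.Build _ _ _ _ _ mZ).
have E A : measurable A -> (distribution P X' \x mu)%E A = distribution P Z A.
  by move=> mA; exact: (product_measure_unique (m1 := distribution P X') (m2 := mu)).
transitivity (\int[distribution P Z]_y h y)%E.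
  by rewrite ge0_integral_distribution.
transitivity (\int[distribution P X' \x mu]_y h y)%E.
  by apply: eq_measure_integral => A mA _; exact/esym/E.
rewrite fubini_tonelli1// ge0_integral_distribution//.
  exact: measurable_fun_fubini_tonelli_F.
by move=> y; apply: integral_ge0.
Qed.

End Freezing.

Section Past.
Context {d : measure_display} {Omega : measurableType d} {R : realType} {p : nat}.
Variable P : probability Omega R.
Variable S : nat -> {RV P >-> sketch R p}.
Variable hist : set (set Omega).
Hypothesis hist_sigma : sigma_algebra setT hist.
Hypothesis hist_measurable : hist `<=` measurable.

Let F (o : option nat) : set (set Omega) :=
  if o is Some j then g_sigma_algebra_preimage (S j) else hist.

Hypothesis F_indep : independent_sigma P F.

Definition past (j : nat) : set (set Omega) :=
  hist `|` \bigcup_(i in [set i | (i < j)%N]) g_sigma_algebra_preimage (S i).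

Let F_sigma o : sigma_algebra setT (F o).
Proof.
by case: o => [j|] //; exact: sigma_algebra_preimage (sigma_algebra_measurable _).
Qed.

Let F_measurable o : F o `<=` measurable.
Proof.
by case: o => [j|] //= _ [B mB <-]; rewrite setTI; exact: measurable_funPTI.
Qed.

Let FT o : F o setT.
Proof. by have [F0 FC _] := F_sigma o; rewrite -(setD0 setT); exact: FC. Qed.

Let F_setI o A B : F o A -> F o B -> F o (A `&` B).
Proof.
by have /sigma_algebraP[//|_ _ _] := F_sigma o; apply.
Qed.

Let indices j : seq (option nat) := None :: [seq Some i | i <- iota 0 j].

Let uniq_indices j : uniq (indices j).
Proof.
by rewrite /= map_inj_uniq ?iota_uniq ?andbT => [|i i' []//]; apply/mapP => -[].
Qed.

Let mem_indices j i : (Some i \in indices j) = (i < j)%N.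
Proof. by rewrite inE /= mem_map ?mem_iota ?add0n// => i1 i2 []. Qed.

(* The finite intersections form a pi-system that generates the past. *)
Let cylinder j : set (set Omega) := [set A | exists2 E,
  (forall o, F o (E o)) & A = \bigcap_(o in [set` indices j]) E o].

Let cylinder_measurable j : cylinder j `<=` measurable.
Proof.
move=> _ [E FE ->]; apply: fin_bigcap_measurable; first exact: finite_seq.
by move=> o _; exact: F_measurable.
Qed.

Let cylinderI j : setI_closed (cylinder j).
Proof.
move=> _ _ [E1 F1 ->] [E2 F2 ->]; exists (fun o => E1 o `&` E2 o).
  by move=> o; exact: F_setI.
by rewrite bigcapI.
Qed.

Let cylinderT j : cylinder j setT.
Proof.
by exists (fun=> setT) => //; rewrite bigcapT.
Qed.

Let past_cylinder j : past j `<=` cylinder j.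
Proof.
have one o A : o \in indices j -> F o A -> cylinder j A.
  move=> oj FA; exists (fun o' => if o' == o then A else setT).
    by move=> o'; case: eqP => [->|].
  apply/seteqP; split=> [w Aw o' _|w /(_ o oj)]; last by rewrite eqxx.
  by case: ifP.
move=> A [hA|[i /= ij SA]]; first by apply: (one None).
by apply: (one (Some i)) => //; rewrite mem_indices.
Qed.

(** Grouping of independence: a sketch is independent of everything drawn
    before it, because the product rule on finite intersections extends to the
    generated sigma-algebra. *)
Lemma past_indep j A B : <<s past j >> A -> measurable B ->
  P (A `&` S j @^-1` B) = (P A * P (S j @^-1` B))%E.
Proof.
move=> pA mB; have mE : measurable (S j @^-1` B) by exact: measurable_funPTI.
set E := S j @^-1` B in mE *.
have Efin : P E \is a fin_num by exact: fin_num_measure.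
pose r : {nonneg R} := NngNum (fine_ge0 (measure_ge0 P E)).
have cA : <<s cylinder j >> A.
  by apply: sub_smallest2r pA; [exact: smallest_sigma_algebra|exact: past_cylinder].
have := @g_sigma_algebra_measure_unique _ R Omega (cylinder j)
  (@cylinder_measurable j) (fun=> setT) (fun=> @cylinderT j) _
  (mrestr P mE) (mscale r P) (@cylinderI j).
have rE : P E = r%:num%:E by rewrite /= fineK.
move=> H; rewrite [RHS]muleC rE; apply: (H _ _ _ _ cA).
- by rewrite bigcup_const//; exists 0%N.
- move=> _ [G FG ->].
  change (P (\bigcap_(o in [set` indices j]) G o `&` E) =
    r%:num%:E * P (\bigcap_(o in [set` indices j]) G o))%E.
  rewrite -rE.
  pose G' o := if o == Some j then E else G o.
  have FG' o : F o (G' o).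
    by rewrite /G'; case: eqP => [->|//]; exists B; rewrite ?setTI.
  have jnot : Some j \notin indices j by rewrite mem_indices ltnn.
  have GG' o : o \in indices j -> G' o = G o.
    by rewrite /G'; case: eqP => [->|//]; rewrite (negbTE jnot).
  have E1 : \bigcap_(o in [set` indices j]) G o `&` E =
      \bigcap_(o in [set` Some j :: indices j]) G' o.
    apply/seteqP; split=> [w [Gw Ew] o|w G'w].
      rewrite /= inE => /orP[/eqP ->|oj]; first by rewrite /G' eqxx.
      by rewrite GG'//; exact: Gw.
    split; last by have := G'w (Some j); rewrite /G' eqxx; apply; rewrite /= mem_head.
    by move=> o oj; rewrite -GG'//; apply: G'w; rewrite /= inE oj orbT.
  have u1 : uniq (Some j :: indices j) by rewrite cons_uniq jnot uniq_indices.
  rewrite E1 (F_indep u1 (fun o _ => FG' o)) (F_indep (uniq_indices j) (fun o _ => FG o)).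
  rewrite big_cons.
  rewrite {1}/G' eqxx; congr (_ * _)%E; rewrite big_seq [RHS]big_seq.
  by apply: eq_bigr => o oj; rewrite GG'.
- by move=> _; rewrite /= /mrestr setTI ltey_eq Efin.
Qed.

Lemma past_measurable j : <<s past j >> `<=` measurable.
Proof.
apply: smallest_sub; first exact: sigma_algebra_measurable.
by move=> A /past_cylinder; exact: cylinder_measurable.
Qed.

Lemma past_mono j : <<s past j >> `<=` <<s past j.+1 >>.
Proof.
apply: sub_smallest2r; first exact: smallest_sigma_algebra.
move=> A [hA|[i /= ij SA]]; [by left|right].
by exists i => //=; exact: ltnW.
Qed.

Local Notation past_type j := (g_sigma_algebraType (past j)).

Lemma past_measurable_fun j d' (T' : measurableType d') (f : Omega -> T') :
  measurable_fun setT (f : past_type j -> T') -> measurable_fun setT f.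
Proof.
by move=> mf _ Y mY; apply: (@past_measurable j); exact: (mf measurableT _ mY).
Qed.

Lemma past_measurable_funS j d' (T' : measurableType d') (f : Omega -> T') :
  measurable_fun setT (f : past_type j -> T') ->
  measurable_fun setT (f : past_type j.+1 -> T').
Proof.
by move=> mf _ Y mY; apply: past_mono; exact: (mf measurableT _ mY).
Qed.

Lemma sketch_past_measurable j :
  measurable_fun setT (S j : past_type j.+1 -> sketch R p).
Proof.
move=> _ Y mY; apply: sub_sigma_algebra; right; exists j => //=.
by exists Y.
Qed.

Lemma history_past_measurable j d' (T' : measurableType d') (f : Omega -> T') :
  (forall Y, measurable Y -> hist (f @^-1` Y)) ->
  measurable_fun setT (f : past_type j -> T').
Proof.
move=> hf _ Y mY; rewrite setTI; apply: sub_sigma_algebra; left; exact: hf.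
Qed.

End Past.

(** * Almost sure convergence of the error process *)

Section ErrorProcess.
Context {d : measure_display} {Omega : measurableType d} {R : realType} {p : nat}.
Variable P : probability Omega R.
Variable S : nat -> {RV P >-> sketch R p}.
Variable hist : set (set Omega).
Hypothesis hist_sigma : sigma_algebra setT hist.
Hypothesis hist_measurable : hist `<=` measurable.
Hypothesis indep : independent_sigma P (fun o : option nat =>
  if o is Some j then g_sigma_algebra_preimage (S j) else hist).
Variables (mu : probability (sketch R p) R) (pi0 : R).
Hypothesis law : forall j A, measurable A -> distribution P (S j) A = mu A.
Hypothesis pi0_gt0 : 0 < pi0.
Hypothesis sketch_nonzero : forall u : 'cV[R]_p, u != 0 ->
  (pi0%:E <= mu [set M : sketch R p | ((tagged M)^T *m u != 0)%R])%E.

Variables (Gamma : Omega -> 'M[R]_p) (Y : Omega -> 'cV[R]_p) (N : R).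
Hypothesis Gamma_hist : forall i j U, measurable U ->
  hist ((fun w => Gamma w i j) @^-1` U).
Hypothesis Y_hist : forall i U, measurable U -> hist ((fun w => Y w i 0) @^-1` U).
Hypothesis Y_le : forall w, norm2 (Y w) ^+ 2 <= N.

Local Notation past_type j := (g_sigma_algebraType (past S hist j)).

(** The error of the inner solver, with a bounded initial value [Y] instead of
    the exact one so that the energies are integrable. *)
Fixpoint error (j : nat) (w : Omega) : 'cV[R]_p :=
  if j is j'.+1 then error j' w - sketch_proj (Gamma w) (S j' w) *m error j' w
  else Y w.

Let Gamma_past j : measurable_mx (Gamma : past_type j -> 'M[R]_p).
Proof. by move=> i k; apply: history_past_measurable => U; exact: Gamma_hist. Qed.

Lemma error_measurable j : measurable_mx (error j : past_type j -> 'cV[R]_p).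
Proof.
elim: j => [|j IH].
  by move=> i k; rewrite (ord1 k); apply: history_past_measurable => U; exact: Y_hist.
have IH' : measurable_mx (error j : past_type j.+1 -> 'cV[R]_p).
  by move=> i k; exact: (past_measurable_funS (IH i k)).
apply: measurable_mxB => //; apply: measurable_sketch_proj => //.
exact: sketch_past_measurable.
Qed.

Let capture j w := captured (Gamma w) (S j w) (error j w).

Let capture_sum J w :
  \sum_(0 <= j < J) capture j w = norm2 (Y w) ^+ 2 - norm2 (error J w) ^+ 2.
Proof.
elim: J => [|J IH]; first by rewrite big_nil subrr.
by rewrite big_nat_recr//= IH captured_pythagoras /capture; ring.
Qed.

Let joint j (x : past_type j * sketch R p) : \bar R :=
  (captured (Gamma x.1) x.2 (error j x.1))%:E.

Let joint_measurable j : measurable_fun setT (@joint j).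
Proof.
apply/measurable_EFinP; apply: (@measurable_captured R _ _ p
  (fun x : past_type j * sketch R p => Gamma x.1) snd _ _ (fun x => error j x.1)).
- by move=> i k; exact: (measurableT_comp (@Gamma_past j i k) measurable_fst).
- exact: measurable_snd.
- by move=> i k; exact: (measurableT_comp (@error_measurable j i k) measurable_fst).
Qed.

Let joint_ge0 j x : (0 <= @joint j x)%E.
Proof. by rewrite lee_fin captured_ge0. Qed.

Let mean j w := mean_captured mu (Gamma w) (error j w).

Let mean_measurable j : measurable_fun setT (mean j).
Proof.
apply: (@past_measurable_fun _ _ _ _ P S hist hist_sigma hist_measurable j).
exact: (measurable_fun_fubini_tonelli_F (m2 := mu) (@joint j) (@joint_measurable j)
  (@joint_ge0 j)).
Qed.

Let capture_measurable j : measurable_fun setT (capture j).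
Proof.
apply: measurable_captured => [i k||i k].
- exact: (past_measurable_fun hist_sigma hist_measurable (@Gamma_past j i k)).
- exact: measurable_funPT.
- exact: (past_measurable_fun hist_sigma hist_measurable (@error_measurable j i k)).
Qed.

Let capture_mean j : (\int[P]_w (capture j w)%:E = \int[P]_w mean j w)%E.
Proof.
pose X : Omega -> past_type j := id.
have mX : measurable_fun setT X.
  by move=> _ U mU; rewrite setTI; exact: (past_measurable hist_sigma hist_measurable mU).
have XS A B : measurable A -> measurable B ->
    P (X @^-1` A `&` S j @^-1` B) = (P (X @^-1` A) * mu B)%E.
  move=> mA mB; rewrite -(law j mB).
  exact: (past_indep hist_sigma hist_measurable indep mA mB).
exact: (ge0_integral_freezing mX (measurable_funPT (S j)) XS
  (@joint_measurable j) (@joint_ge0 j)).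
Qed.

(** The captured energies telescope, so their expectations sum to at most [N];
    each equals the expectation of a fixed fraction of the error energy. *)
Lemma error_to_zero : {ae P, forall w, Gamma w \in unitmx ->
  forall e, 0 < e -> exists J, forall j, (J <= j)%N -> norm2 (error j w) <= e}.
Proof.
have mean0 j w : (0 <= mean j w)%E by exact: mean_captured_ge0.
have mcE j : measurable_fun setT (fun w => (capture j w)%:E).
  by apply/measurable_EFinP; exact: capture_measurable.
have capture0 j w : (0 <= (capture j w)%:E)%E by rewrite lee_fin captured_ge0.
have sum_le : (\int[P]_w (\sum_(0 <= j <oo) mean j w) <= N%:E)%E.
  rewrite integral_nneseries//; apply: lime_le.
    by apply: is_cvg_nneseries => j _ _; exact: integral_ge0.
  near=> J.
  have -> : (\sum_(0 <= j < J) \int[P]_w mean j w =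
             \int[P]_w (\sum_(0 <= j < J) (capture j w)%:E))%E.
    rewrite ge0_integral_sum//.
    by apply: eq_bigr => j _; rewrite capture_mean.
  apply: (@le_trans _ _ (\int[P]_w N%:E)%E).
    apply: ge0_le_integral => //.
    - by move=> w _; apply: sume_ge0.
    - exact: emeasurable_sum.
    - move=> w _; rewrite sumEFin lee_fin capture_sum.
      by apply: le_trans (Y_le w); rewrite gerBl sqr_ge0.
  by rewrite integral_cst//= [X in (_ * X)%E](probability_setT P) mule1.
have fin : P.-integrable setT (fun w => \sum_(0 <= j <oo) mean j w)%E.
  apply/integrableP; split; first exact: ge0_emeasurable_sum.
  apply: (@le_lt_trans _ _ N%:E); last exact: ltry.
  apply: le_trans sum_le; rewrite le_eqVlt; apply/orP; left; apply/eqP.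
  by apply: eq_integral => w _; rewrite gee0_abs// nneseries_ge0.
have := integrable_ae measurableT fin; apply: filterS => w /(_ Logic.I) sw Gu e e0.
have [k k0 hk] := mean_captured_lower pi0_gt0 sketch_nonzero Gu.
set s := (\sum_(0 <= j <oo) mean j w)%E in sw.
have err_mono i j : (i <= j)%N -> norm2 (error j w) ^+ 2 <= norm2 (error i w) ^+ 2.
  elim: j => [|j IH]; first by rewrite leqn0 => /eqP ->.
  rewrite leq_eqVlt => /orP[/eqP -> //|]; rewrite ltnS => /IH; apply: le_trans.
  by rewrite /= captured_pythagoras gerBl captured_ge0.
have bound J : J%:R * (k * norm2 (error J w) ^+ 2) <= fine s.
  rewrite -lee_fin fineK//; apply: (@le_trans _ _ (\sum_(0 <= j < J) mean j w)%E).
    2: by apply: nneseries_lim_ge => j *; exact: mean0.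
  apply: (@le_trans _ _ (\sum_(0 <= j < J) (k * norm2 (error J w) ^+ 2)%:E)%E).
    by rewrite sumEFin sumr_const_nat subn0 mulr_natl.
  rewrite big_nat [leRHS]big_nat; apply: lee_sum => j /andP[_ jJ].
  apply: le_trans (hk _); rewrite lee_fin ler_pM2l//; apply: err_mono.
  exact: ltnW.
have ke : 0 < k * e ^+ 2 by rewrite mulr_gt0// exprn_gt0.
exists (Num.bound (`|fine s| / (k * e ^+ 2))) => j Jj.
rewrite leNgt; apply/negP => ej.
have := archi_boundP (divr_ge0 (normr_ge0 (fine s)) (ltW ke)).
rewrite ltr_pdivrMr// => sJ.
have := le_lt_trans (ler_norm _) sJ; apply/negP; rewrite -leNgt.
apply: le_trans (bound j); apply: ler_pM; rewrite ?ler_nat//; first exact: ltW.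
by rewrite ler_pM2l// ler_pXn2r ?nnegrE ?norm2_ge0// ltW.
Unshelve. all: by end_near. Qed.

End ErrorProcess.

(** * Convergence of the algorithm *)

Section ResidualOfError.
Context {R : realType} {p : nat}.
Variables (Gamma : 'M[R]_p) (g : 'cV[R]_p) (S : nat -> sketch R p).
Hypothesis Gamma_sym : Gamma^T = Gamma.
Hypothesis Gamma_unit : Gamma \in unitmx.
Variable err : nat -> 'cV[R]_p.
Hypothesis err0 : err 0 = \adj Gamma *m g.
Hypothesis errS : forall j, err j.+1 = err j - sketch_proj Gamma (S j) *m err j.

(** Starting the error recursion at [\adj Gamma *m g] scales all errors by the
    determinant, and makes its initial value a polynomial in the data. *)
Lemma error_scaled j :
  err j = \det Gamma *: (sketch_iterate Gamma g S j + invmx Gamma *m g).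
Proof.
elim: j => [|j IH].
  rewrite err0 /= add0r scalemxAr -mul_scalar_mx -mul_mx_adj -!mulmxA mulmxA.
  by rewrite mulVmx// mul1mx.
have Gd : Gamma *m (- (invmx Gamma *m g)) = - g.
  by rewrite mulmxN mulmxA mulmxV// mul1mx.
have := sketch_update_error (S j) (sketch_iterate Gamma g S j) Gamma_sym Gd.
by rewrite /= opprK => ->; rewrite scalerBr scalemxAr -IH errS.
Qed.

Lemma residual_small_of_error :
  (forall e, 0 < e -> exists J, forall j, (J <= j)%N -> norm2 (err j) <= e) ->
  forall e, 0 < e -> exists J, forall j, (J <= j)%N ->
    norm2 (Gamma *m sketch_iterate Gamma g S j + g) <= e.
Proof.
move=> small e e0; have d0 : \det Gamma != 0 by rewrite -unitfE -unitmxE.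
have nd : 0 < `|\det Gamma| by rewrite normr_gt0.
have o1 : 0 < opnorm Gamma + 1 by rewrite ltr_wpDl// opnorm_ge0.
have [|J hJ] := small (e * `|\det Gamma| / (opnorm Gamma + 1)).
  by rewrite divr_gt0// mulr_gt0.
exists J => j /hJ; rewrite error_scaled norm2Z ler_pdivlMr// -mulrA [leLHS]mulrC.
rewrite ler_pM2r// => h.
have -> : Gamma *m sketch_iterate Gamma g S j + g =
    Gamma *m (sketch_iterate Gamma g S j + invmx Gamma *m g).
  by rewrite mulmxDr mulmxA mulmxV// mul1mx.
apply: le_trans (norm2_mulmx _ _) _; apply: le_trans h; rewrite [leRHS]mulrC.
by apply: ler_wpM2r; [exact: norm2_ge0|rewrite lerDl].
Qed.

End ResidualOfError.

Section AlmostSureResiduals.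
Context {d : measure_display} {Omega : measurableType d} {R : realType}.
Context {n m : nat}.
Variable P : probability Omega R.
Variables (f : 'cV[R]_n -> R) (c : 'cV[R]_n -> 'cV[R]_m).
Hypothesis f_C2 : twice_continuously_differentiable f.
Hypothesis c_C2 : forall i, twice_continuously_differentiable (fun x => c x i 0).
Variables (S : nat -> nat -> {RV P >-> sketch R (n + m)}).
Variables (z : nat -> {RV P >-> borel_mx R (n + m) 1}).
Variables (B : nat -> {RV P >-> borel_mx R n n}).

Lemma history_sigma k : sigma_algebra setT (history S z B k).
Proof. exact: smallest_sigma_algebra. Qed.

Lemma history_measurable k : history S z B k `<=` measurable.
Proof.
apply: smallest_sub; first exact: sigma_algebra_measurable.
move=> A [[i _ [[U mU <-]|[U mU <-]]]|[i _ [j _ [U mU <-]]]];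
  by rewrite setTI; exact: measurable_funPTI.
Qed.

Lemma history_iterate k (h : 'cV[R]_(n + m) -> R) U : continuous h ->
  measurable U -> history S z B k ((fun w => h (z k w)) @^-1` U).
Proof.
move=> hc mU; apply: sub_sigma_algebra; left; exists k => /=; first exact: leqnn.
left; exists (h @^-1` U : set (borel_mx R (n + m) 1)); last by rewrite setTI.
by rewrite -[X in measurable X]setTI; exact: borel_continuous_measurable.
Qed.

Lemma history_modification k (h : 'M[R]_n -> R) U : continuous h ->
  measurable U -> history S z B k ((fun w => h (B k w)) @^-1` U).
Proof.
move=> hc mU; apply: sub_sigma_algebra; left; exists k => /=; first exact: leqnn.
right; exists (h @^-1` U : set (borel_mx R n n)); last by rewrite setTI.
by rewrite -[X in measurable X]setTI; exact: borel_continuous_measurable.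
Qed.

Let Gamma k w : 'M[R]_(n + m) :=
  newton_mx (B k w : 'M[R]_n) (jac c (usubmx (z k w : 'cV[R]_(n + m)))).
Let g k w : 'cV[R]_(n + m) := kkt_residual f c (z k w).

Lemma history_newton_mx k i j U : measurable U ->
  history S z B k ((fun w => Gamma k w i j) @^-1` U).
Proof.
move=> mU; rewrite /Gamma /newton_mx.
case: (split_ordP i) => a ->; case: (split_ordP j) => b ->.
- under eq_fun do rewrite block_mxEul.
  by apply: (@history_modification k (fun M => M a b)) => //; exact: coord_continuous.
- under eq_fun do rewrite block_mxEur mxE.
  apply: (@history_iterate k (fun x => jac c (usubmx x) b a)) => //.
  exact: continuous_jac.
- under eq_fun do rewrite block_mxEdl.
  apply: (@history_iterate k (fun x => jac c (usubmx x) a b)) => //.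
  exact: continuous_jac.
- under eq_fun do rewrite block_mxEdr mxE.
  by apply: (@history_iterate k (fun=> 0)) => //; exact: cst_continuous.
Qed.

Lemma history_kkt_residual k i U : measurable U ->
  history S z B k ((fun w => g k w i 0) @^-1` U).
Proof.
move=> mU; apply: (@history_iterate k (fun x => kkt_residual f c x i 0)) => //.
exact: continuous_kkt_residual.
Qed.

Local Notation hist_type k := (g_sigma_algebraType (history S z B k)).

(* The generated sigma-algebra of a sigma-algebra is itself. *)
Let hist_measurableP k U : measurable (U : set (hist_type k)) -> history S z B k U.
Proof. by apply: smallest_sub; first exact: history_sigma. Qed.

Variables (mu : probability (sketch R (n + m)) R) (pi0 : R).
Hypothesis sketches_iid : fresh_iid_sketches S z B mu.
Hypothesis pi0_gt0 : 0 < pi0.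
Hypothesis sketch_nonzero : forall u : 'cV[R]_(n + m), u != 0 ->
  (pi0%:E <= mu [set M : sketch R (n + m) | ((tagged M)^T *m u != 0)%R])%E.

(* Cutting off where the initial error is large makes it bounded; at every
   sample point the cut-off is inactive for large [N]. *)
Let start k (N : nat) w : 'cV[R]_(n + m) :=
  \1_[set w | norm2 (\adj (Gamma k w) *m g k w) ^+ 2 <= N%:R] w *:
    (\adj (Gamma k w) *m g k w).

Let start_le k N w : norm2 (start k N w) ^+ 2 <= N%:R.
Proof.
rewrite /start indicE; case: (boolP (w \in _)) => [|_].
  by rewrite inE scale1r.
by rewrite scale0r norm20 expr0n.
Qed.

Let start_history k N i U : measurable U ->
  history S z B k ((fun w => start k N w i 0) @^-1` U).
Proof.
move=> mU.
have mG : measurable_mx (Gamma k : hist_type k -> _).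
  by move=> a b _ V mV; rewrite setTI; apply: sub_sigma_algebra; exact: history_newton_mx.
have mg : measurable_mx (g k : hist_type k -> _).
  move=> a b _ V mV; rewrite (ord1 b) setTI; apply: sub_sigma_algebra.
  exact: history_kkt_residual.
have mag : measurable_mx ((fun w => \adj (Gamma k w) *m g k w) : hist_type k -> _).
  by apply: measurable_mxM => //; exact: measurable_adj.
have mA : measurable ([set w | norm2 (\adj (Gamma k w) *m g k w) ^+ 2 <= N%:R]
    : set (hist_type k)).
  have := measurable_norm2_sqr mag measurableT (measurable_itv `]-oo, N%:R : R]).
  by rewrite setTI; congr measurable; apply/seteqP; split=> w /=; rewrite in_itv.
have : measurable_mx (start k N : hist_type k -> _).
  by apply: measurable_mxZ => //; exact: measurable_indic.
by move=> /(_ i 0 measurableT _ mU); rewrite setTI; exact: hist_measurableP.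
Qed.

(** Almost surely every inner solver converges, wherever its Newton matrix is
    symmetric and invertible. *)
Lemma residuals_to_zero : {ae P, forall w, forall k,
  (Gamma k w)^T = Gamma k w -> Gamma k w \in unitmx ->
  forall e, 0 < e -> exists J, forall j, (J <= j)%N ->
    norm2 (Gamma k w *m sketch_iterate (Gamma k w) (g k w) (fun j => S k j w) j
      + g k w) <= e}.
Proof.
have [law indep] := sketches_iid.
have H k N : {ae P, forall w, Gamma k w \in unitmx ->
    forall e, 0 < e -> exists J, forall j, (J <= j)%N ->
    norm2 (error (S k) (Gamma k) (start k N) j w) <= e}.
  apply: (error_to_zero (history_sigma k) (@history_measurable k) (indep k) (law k)
    pi0_gt0 sketch_nonzero (@history_newton_mx k) (@start_history k N)).
  exact: (@start_le k N).
have := ae_foralln (fun k => ae_foralln (H k)); apply: filterS => w Hw k Gs Gu.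
pose v := \adj (Gamma k w) *m g k w.
pose N := Num.bound (norm2 v ^+ 2).
have sE : start k N w = v.
  rewrite /start indicE mem_set ?scale1r//=.
  by apply/ltW/archi_boundP; exact: sqr_ge0.
apply: (@residual_small_of_error _ _ _ _ _ Gs Gu
  (fun j => error (S k) (Gamma k) (start k N) j w)) => //.
exact: Hw.
Qed.

End AlmostSureResiduals.

Theorem theorem3p10
  (R : realType) (n m : nat) (m_gt0 : (0 < m)%N)
  (f : 'cV[R]_n -> R) (c : 'cV[R]_n -> 'cV[R]_m)
  (f_C2 : twice_continuously_differentiable f)
  (c_C2 : forall i, twice_continuously_differentiable (fun x => c x i 0))
  (* inputs of the algorithm *)
  (prm : inputs R) (z0 : 'cV[R]_(n + m)) (eta10 eta20 delta0 : R)
  (theta_range : forall k, 0 < theta prm k <= 1)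
  (eta10_gt0 : 0 < eta10) (eta20_gt0 : 0 < eta20) (xi_B_gt0 : 0 < xi_B prm)
  (delta0_range : 0 < delta0 < 1) (beta_range : 0 < beta prm < 2^-1)
  (nu_gt1 : 1 < nu prm)
  (alpha_max_gt0 : 0 < alpha_max prm) (rho_range : 0 < rho prm < 1)
  (* random run of the algorithm *)
  (d : measure_display) (Omega : measurableType d) (P : probability Omega R)
  (S : nat -> nat -> {RV P >-> sketch R (n + m)})
  (z : nat -> {RV P >-> borel_mx R (n + m) 1})
  (B : nat -> {RV P >-> borel_mx R n n})
  (eta1 eta2 delta : nat -> Omega -> R)
  (run : forall w, adasketch_newton f c prm z0 eta10 eta20 delta0
     (fun k j => S k j w) (fun k => z k w) (fun k => B k w)
     (fun k => eta1 k w) (fun k => eta2 k w) (fun k => delta k w))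
  (* (i) *)
  (X : set 'cV[R]_n) (Lambda : set 'cV[R]_m)
  (X_compact : compact X) (Lambda_compact : compact Lambda)
  (X_convex : convex_set X) (Lambda_convex : convex_set Lambda)
  (iterates_in : {ae P, forall w, forall k,
     X (usubmx (z k w : 'cV[R]_(n + m))) /\
     Lambda (dsubmx (z k w : 'cV[R]_(n + m)))})
  (f_lipschitz : hessian_lipschitz_on X f)
  (c_lipschitz : forall i, hessian_lipschitz_on X (fun x => c x i 0))
  (* (ii) *)
  (xi_G Upsilon_B : R) (xi_G_gt0 : 0 < xi_G) (Upsilon_B_gt0 : 0 < Upsilon_B)
  (matrices_bounded : {ae P, forall w, forall k,
     let G := jac c (usubmx (z k w : 'cV[R]_(n + m))) in
     let Bk : 'M[R]_n := B k w in
     [/\ row_free G,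
         forall u : 'cV[R]_m, 0 <= dotv u ((G *m G^T - xi_G%:M) *m u),
         forall u : 'cV[R]_n, G *m u = 0 ->
           xi_B prm * norm2 u ^+ 2 <= dotv u (Bk *m u) &
         opnorm Bk <= Upsilon_B]})
  (* (iii) *)
  (mu : probability (sketch R (n + m)) R)
  (sketches_iid : fresh_iid_sketches S z B mu)
  (pi0 : R) (pi0_range : 0 < pi0 <= 1)
  (sketch_nonzero : forall u : 'cV[R]_(n + m), u != 0 ->
     (pi0%:E <= mu [set M : sketch R (n + m) | ((tagged M)^T *m u != 0)%R])%E) :
  {ae P, forall w,
     (fun k => norm2 (kkt_residual f c (z k w))) @ \oo --> (0 : R)}.
Proof.
have /andP[pi0_gt0 _] := pi0_range.
have res := residuals_to_zero f_C2 c_C2 sketches_iid pi0_gt0 sketch_nonzero.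
apply: filterS (filterI iterates_in (filterI matrices_bounded res)).
move=> w [in_w [mat_w res_w]].
have reg k : regular_point c prm X Lambda xi_G Upsilon_B (z k w) (B k w).
  have [Gf Gl Bk BU] := mat_w k.
  by split => //; split; [exact: in_w|exact: (adasketch_sym (run w) k)].
apply: (realization_converges m_gt0 f_C2 c_C2 eta10_gt0 eta20_gt0 xi_B_gt0
  delta0_range beta_range nu_gt1 X_compact Lambda_compact xi_G_gt0 Upsilon_B_gt0
  (run w) theta_range alpha_max_gt0 rho_range reg) => k.
apply: res_w.
  rewrite /newton_mx tr_block_mx trmxK trmx0.
  by rewrite (adasketch_sym (run w) k).
have [C _ hC] := @newton_mx_lower R n m _ _ _ xi_G_gt0 xi_B_gt0 Upsilon_B_gt0.
have [_ Gf Gl Bk BU] := reg k.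
exact: unitmx_lower (hC _ _ Gf Gl Bk BU).
Qed.
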